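(* Let $\Gamma$ be an uncountable set with $\kappa=|\Gamma|$, and let $X$ be a Banach space. Assume that one of the following holds: (UF) $X$ has the uniform primary factorisation property; (CF) $X$ has the primary factorisation property and $\operatorname{cf}(\kappa)>\omega$. Then the following assertions hold. (i) If $\kappa>\omega_1$ and $X$ is weakly compactly generated, then $\ell_1(\Gamma,X)$ has the primary factorisation property, and it has the uniform primary factorisation property in case (UF). (ii) Let $E$ be a Banach space with a symmetric basis $(e_\gamma)_{\gamma\in\Gamma}$ not equivalent to the canonical basis of $\ell_1(\Gamma)$. If $X$ is separable, then $E(\Gamma,X)$ has the primary factorisation property, and it has the uniform primary factorisation property in case (UF). (No cardinality assumption on $\Gamma$ beyond uncountability is made here.) (iii) Let $E$ be a Banach space with a symmetric basis $(e_\gamma)_{\gamma\in\Gamma}$ not equivalent to the canonical basis of $\ell_1(\Gamma)$. If $\kappa>\omega_1$ and $X^*$ contains a countable total set, then $E(\Gamma,X)$ has the primary factorisation property, and it has the uniform primary factorisation property in case (UF).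
   Context: Banach spaces are over $\mathbb K\in\{\mathbb R,\mathbb C\}$; operators are bounded and linear. A Banach space $Z$ has the primary factorisation property (PFP) if for every operator $T\colon Z\to Z$ there are operators $U,V\colon Z\to Z$ with $UTV=\mathrm{Id}_Z$ or $U(\mathrm{Id}_Z-T)V=\mathrm{Id}_Z$. It has the $C$-PFP ($C\ge1$) if $U,V$ can always be chosen with moreover $\|U\|\,\|V\|\le C$, and the uniform primary factorisation property (UPFP) if it has the $C$-PFP for some $C\ge 1$. A normalised basis $(e_\gamma)_{\gamma\in\Gamma}$ of $E$ is symmetric if it is equivalent to each of its permutations and sign-changes; after passing to an equivalent norm, $E$ is assumed to carry a symmetric norm, i.e. $\|\sum_\gamma \varepsilon_\gamma a_\gamma e_{\pi(\gamma)}\|=\|\sum_\gamma a_\gamma e_\gamma\|$ for all permutations $\pi$ of $\Gamma$ and all unimodular $(\varepsilon_\gamma)$; in particular the basis is $1$-unconditional. $E(\Gamma,X)$ is the Banach space of families $x=(x_\gamma)_{\gamma\in\Gamma}$ in $X$ such that $\sum_{\gamma}\|x_\gamma\|e_\gamma\in E$ (unordered convergence), with norm $\|x\|=\|\sum_\gamma\|x_\gamma\|e_\gamma\|_E$; $\ell_1(\Gamma,X)$ is the case of the canonical basis of $\ell_1(\Gamma)$. A set $M\subseteq X^*$ is total if $x^*(x)=0$ for all $x^*\in M$ implies $x=0$. WCG means being the closed linear span of a weakly compact set. $\operatorname{cf}$ denotes cofinality. *)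

(* Defs.v *)
From HB Require Import structures.
From mathcomp Require Import all_boot all_order all_algebra finmap.
From mathcomp Require Import all_classical all_reals topology normedtype complex.

Set Implicit Arguments.
Unset Strict Implicit.
Unset Printing Implicit Defensive.

Import Order.TTheory GRing.Theory Num.Theory numFieldNormedType.Exports.

Local Open Scope classical_set_scope.
Local Open Scope card_scope.
Local Open Scope ring_scope.

(* Unordered convergence: the net of finite partial sums, indexed by the      *)
(* finite subsets of I directed by inclusion.                                 *)
Definition finite_subsets (I : choiceType) : set_system {fset I} :=
  filter_from setT (fun A : {fset I} => [set B | (A `<=` B)%fset]).
Arguments finite_subsets : clear implicits.

Global Instance finite_subsets_filter (I : choiceType) :
  ProperFilter (finite_subsets I).
Proof.
apply: filter_from_proper; last by move=> A _; exists A; exact: fsubset_refl.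
apply: filter_from_filter; first by exists fset0.
move=> A B _ _; exists (A `|` B)%fset => // C; rewrite /= fsubUset.
by case/andP.
Qed.

Lemma sum_fsetU (I : choiceType) (V : nmodType) (A B : {fset I}) (x : I -> V) :
  [disjoint A & B]%fset ->
  \sum_(i <- (A `|` B)%fset) x i = \sum_(i <- A) x i + \sum_(i <- B) x i.
Proof.
move=> AB; rewrite -big_cat; apply: perm_big; apply: uniq_perm => //=.
  rewrite cat_uniq !fset_uniq andbT/= -all_predC; apply/allP => i iB/=.
  by rewrite fdisjoint_sym in AB; exact: (fdisjointP AB).
by move=> i; rewrite mem_cat inE.
Qed.

Section UnorderedSums.
Context {K : numFieldType} {I : choiceType} {V : normedModType K}.
Implicit Types (x y : I -> V) (s t : V).

Definition usum_to x s :=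
  (fun F : {fset I} => \sum_(i <- F) x i) @ finite_subsets I --> s.

Definition usum x : V := lim ((fun F : {fset I} => \sum_(i <- F) x i) @ finite_subsets I).

Lemma usum_toP x s : usum_to x s <-> forall e : K, 0 < e ->
  exists A : {fset I}, forall B : {fset I}, (A `<=` B)%fset ->
    `|s - \sum_(i <- B) x i| < e.
Proof.
split.
  move=> /cvgrPdist_lt xs e e0; have [A _ HA] := xs e e0.
  by exists A => B AB; apply: HA.
move=> xs; apply/cvgrPdist_lt => e e0; have [A HA] := xs e e0.
by exists A.
Qed.

Lemma usum_toE x s : usum_to x s -> usum x = s.
Proof. exact: cvg_lim. Qed.

Lemma usum_toD x y s t :
  usum_to x s -> usum_to y t -> usum_to (fun i => x i + y i) (s + t).
Proof.
move=> xs yt; rewrite /usum_to.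
rewrite (_ : (fun F : {fset I} => _) = (fun F : {fset I} =>
   \sum_(i <- F) x i + \sum_(i <- F) y i)); first exact: cvgD.
by apply/funext => F; rewrite big_split.
Qed.

Lemma usum_toZ (k : K) x s : usum_to x s -> usum_to (fun i => k *: x i) (k *: s).
Proof.
move=> xs; rewrite /usum_to.
rewrite (_ : (fun F : {fset I} => _) = (fun F : {fset I} =>
   k *: \sum_(i <- F) x i)); first exact: cvgZr.
by apply/funext => F; rewrite scaler_sumr.
Qed.

Lemma usum_to_finite x (A : {fset I}) : (forall i, i \notin A -> x i = 0) ->
  usum_to x (\sum_(i <- A) x i).
Proof.
move=> x0; apply/usum_toP => e e0; exists A => B AB.
rewrite (big_fset_incl _ AB) ?subrr ?normr0//.
by move=> i _ /x0.
Qed.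

Lemma usum_to_le x y s t :
  (forall F : {fset I}, `|\sum_(i <- F) x i| <= `|\sum_(i <- F) y i|) ->
  usum_to x s -> usum_to y t -> `|s| <= `|t|.
Proof.
move=> xy /usum_toP xs /usum_toP yt; apply/ler_addgt0Pr => e e0.
have [A HA] := xs _ (divr_gt0 e0 (ltr0Sn K 1)).
have [B HB] := yt _ (divr_gt0 e0 (ltr0Sn K 1)).
have /ltW hA := HA (A `|` B)%fset (fsubsetUl _ _).
have /ltW hB := HB (A `|` B)%fset (fsubsetUr _ _).
move: hA hB (xy (A `|` B)%fset); set X := \sum_(i <- _) x i.
set Y := \sum_(i <- _) y i => hA hB XY.
rewrite -(subrK X s) (le_trans (ler_normD _ _))//.
rewrite [in leRHS](splitr e) addrCA lerD// (le_trans XY)//.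
by rewrite -(subrKC t Y) addrC (le_trans (ler_normD _ _))// addrC lerD// distrC.
Qed.

Lemma usum_to_norm_le x s (c : K) : (forall F : {fset I}, `|\sum_(i <- F) x i| <= c) ->
  usum_to x s -> `|s| <= c.
Proof.
move=> xc /usum_toP xs; apply/ler_addgt0Pl => e e0.
have [A /(_ A (fsubset_refl _))/ltW HA] := xs _ e0.
by rewrite -(subrK (\sum_(i <- A) x i) s) (le_trans (ler_normD _ _))// lerD.
Qed.

Lemma usum_to_tail x s : usum_to x s -> forall e : K, 0 < e ->
  exists A : {fset I}, forall H : {fset I}, [disjoint A & H]%fset ->
    `|\sum_(i <- H) x i| < e.
Proof.
move=> /usum_toP xs e e0; have [A HA] := xs _ (divr_gt0 e0 (ltr0Sn K 1)).
exists A => H AH; have h1 := HA _ (fsubset_refl _).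
have := HA (A `|` H)%fset (fsubsetUl _ _).
rewrite sum_fsetU// => h2.
rewrite (_ : \sum_(i <- H) x i = (s - \sum_(i <- A) x i) -
  (s - (\sum_(i <- A) x i + \sum_(i <- H) x i))); last first.
  by rewrite opprB !addrA subrK addrAC subrr add0r.
by rewrite (le_lt_trans (ler_normB _ _))// [ltRHS](splitr e) ltrD.
Qed.

Lemma usum_to_bij (p : I -> I) x s : bijective p ->
  usum_to x s -> usum_to (x \o p) s.
Proof.
move=> [q pK qK] /usum_toP xs; apply/usum_toP => e /xs[A HA].
exists [fset q i | i in A]%fset => B AB.
have := HA [fset p i | i in B]%fset.
rewrite big_imfset /=; last by move=> i j _ _; exact: (can_inj pK).
apply; apply/fsubsetP => i iA; apply/imfsetP; exists (q i); rewrite ?qK//=.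
by apply: (fsubsetP AB); apply/imfsetP; exists i.
Qed.

End UnorderedSums.

Lemma usum_to_cauchy (K : numFieldType) (I : choiceType)
    (V : completeNormedModType K) (x : I -> V) :
  (forall e : K, 0 < e -> exists A : {fset I}, forall H : {fset I},
    [disjoint A & H]%fset -> `|\sum_(i <- H) x i| < e) ->
  exists s, usum_to x s.
Proof.
move=> xc; apply/cvg_ex; apply: cauchy_cvg; apply: cauchy_exP => e e0.
have [A HA] := xc _ e0; exists (\sum_(i <- A) x i); exists A => // B /= AB.
have dAB : [disjoint A & (B `\` A)]%fset.
  by apply/fdisjointP => i; rewrite inE => ->.
have -> : B = (A `|` (B `\` A))%fset.
  apply/fsetP => i; rewrite !inE; case: (boolP (i \in A)) => //= iA.
  exact: (fsubsetP AB).
by rewrite sum_fsetU// -ball_normE/= distrC addrAC subrr add0r HA.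
Qed.

(* Vectors for which families of nonnegative coefficients behave as in a      *)
(* Banach lattice; this is all the construction of E(Gamma, X) relies on.     *)
Record solidSys (K : numFieldType) (I : choiceType) (V : normedModType K) :=
  SolidSys {
    solid_vec :> I -> V ;
    solid_norm1 : forall i, `|solid_vec i| = 1 ;
    solid_le : forall (F : {fset I}) (a b : I -> K),
      (forall i, 0 <= a i <= b i) ->
      `|\sum_(i <- F) a i *: solid_vec i| <= `|\sum_(i <- F) b i *: solid_vec i|
  }.

Section VectorFamilies.
Context {K : numFieldType} {I : choiceType} {V : completeNormedModType K}.
Variables (e : solidSys I V) (X : completeNormedModType K).
Implicit Types x y : I -> X.

Definition fam_pred x : bool :=
  `[< exists s : V, usum_to (fun i => `|x i| *: e i) s >].

(* E(Gamma, X) when e is the basis of E: the families x such that the sum of  *)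
(* the `|x i| *: e i converges unordered in E, with the norm of that sum.     *)
Record fam := Fam { fam_val :> I -> X ; fam_valP : fam_pred fam_val }.

HB.instance Definition _ := [isSub for fam_val].
HB.instance Definition _ := [Choice of fam by <:].

Definition fam_sum x : V := usum (fun i => `|x i| *: e i).

Lemma fam_predP x : fam_pred x -> usum_to (fun i => `|x i| *: e i) (fam_sum x).
Proof. by move=> /asboolP[s xs]; rewrite /fam_sum (usum_toE xs). Qed.

Lemma solid_dom (a b : I -> K) (t : V) : (forall i, 0 <= a i <= b i) ->
  usum_to (fun i => b i *: e i) t -> exists s, usum_to (fun i => a i *: e i) s.
Proof.
move=> ab bt; apply: usum_to_cauchy => r /(usum_to_tail bt)[A HA].
by exists A => H /HA; apply: le_lt_trans; exact: solid_le.
Qed.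

Lemma fam_pred_le x (b : I -> K) (t : V) : (forall i, `|x i| <= b i) ->
  usum_to (fun i => b i *: e i) t -> fam_pred x /\ `|fam_sum x| <= `|t|.
Proof.
move=> xb bt; have ab i : 0 <= `|x i| <= b i by rewrite normr_ge0 xb.
have xP : fam_pred x by apply/asboolP; exact: solid_dom bt.
split=> //; apply: usum_to_le (fam_predP xP) bt => F; exact: solid_le.
Qed.

Lemma fam_sum_ge x (F : {fset I}) : fam_pred x ->
  `|\sum_(i <- F) `|x i| *: e i| <= `|fam_sum x|.
Proof.
move=> xP; pose a i := if i \in F then `|x i| else 0.
have aF : usum_to (fun i => a i *: e i) (\sum_(i <- F) a i *: e i).
  by apply: usum_to_finite => i /negbTE iF; rewrite /a iF scale0r.
have -> : \sum_(i <- F) `|x i| *: e i = \sum_(i <- F) a i *: e i.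
  by apply: eq_fbigr => i iF _; rewrite /a iF.
apply: usum_to_le aF (fam_predP xP) => G; apply: solid_le => i.
by rewrite /a; case: ifP; rewrite ?lexx ?normr_ge0.
Qed.

Lemma fam_sum_ge1 x i : fam_pred x -> `|x i| <= `|fam_sum x|.
Proof.
move=> /(fam_sum_ge [fset i]%fset); rewrite big_seq_fset1 normrZ solid_norm1.
by rewrite mulr1 normr_id.
Qed.

Lemma fam_submod_closed : subsemimod_closed fam_pred.
Proof.
split; last first.
  move=> k x xP; apply/asboolP; exists (`|k| *: fam_sum x).
  rewrite (_ : (fun i => _) = (fun i => `|k| *: (`|x i| *: e i))).
    exact: usum_toZ (fam_predP xP).
  by apply/funext => i; rewrite /= scalerA -normrZ.
split.
  apply/asboolP; exists (\sum_(i <- fset0) `|(0 : I -> X) i| *: e i).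
  by apply: usum_to_finite => i _; rewrite normr0 scale0r.
move=> x y xP yP.
have xyt := usum_toD (fam_predP xP) (fam_predP yP).
apply: (@fam_pred_le (x + y) (fun i => `|x i| + `|y i|) _ _ _).1.
  by move=> i; exact: ler_normD.
rewrite (_ : (fun i => _) = (fun i => `|x i| *: e i + `|y i| *: e i)).
  exact: xyt.
by apply/funext => i; rewrite scalerDl.
Qed.

HB.instance Definition _ :=
  GRing.isSubmodClosed.Build K (I -> X) fam_pred fam_submod_closed.
HB.instance Definition _ := [SubChoice_isSubLmodule of fam by <:].

Definition fam_norm (x : fam) : K := `|fam_sum x|.

Lemma fam_normD (x y : fam) : fam_norm (x + y) <= fam_norm x + fam_norm y.
Proof.
have xyt := usum_toD (fam_predP (fam_valP x)) (fam_predP (fam_valP y)).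
apply: (le_trans _ (ler_normD _ _)).
apply: (@fam_pred_le _ (fun i => `|x i| + `|y i|) _ _ _).2.
  by move=> i; exact: ler_normD.
rewrite (_ : (fun i => _) = (fun i => `|x i| *: e i + `|y i| *: e i)).
  exact: xyt.
by apply/funext => i; rewrite scalerDl.
Qed.

Lemma fam_normZ (k : K) (x : fam) : fam_norm (k *: x) = `|k| * fam_norm x.
Proof.
rewrite /fam_norm /fam_sum.
rewrite (usum_toE (s := `|k| *: fam_sum x)) ?normrZ ?normr_id//.
rewrite (_ : (fun i => _) = (fun i => `|k| *: (`|x i| *: e i))).
  exact: usum_toZ (fam_predP (fam_valP x)).
by apply/funext => i; rewrite /= scalerA -normrZ.
Qed.

Lemma fam_norm_eq0 (x : fam) : fam_norm x = 0 -> x = 0.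
Proof.
move=> x0; apply/val_inj/funext => i /=; apply/normr0_eq0/eqP.
by rewrite -normr_le0 normr_id -x0 fam_sum_ge1 ?fam_valP.
Qed.

HB.instance Definition _ :=
  Lmodule_isNormed.Build K fam fam_normD fam_normZ fam_norm_eq0.

Lemma fam_normE (x : fam) : `|x| = `|fam_sum x|.
Proof. by []. Qed.

Lemma fam_subE (x y : fam) i : (x - y) i = x i - y i.
Proof. by []. Qed.

Lemma fam_norm_ge (x : fam) (F : {fset I}) :
  `|\sum_(i <- F) `|x i| *: e i| <= `|x|.
Proof. by rewrite fam_normE fam_sum_ge// fam_valP. Qed.

Lemma fam_norm_ge1 (x : fam) i : `|x i| <= `|x|.
Proof. by rewrite fam_normE fam_sum_ge1// fam_valP. Qed.

Lemma fam_usum (x : fam) : usum_to (fun i => `|x i| *: e i) (fam_sum x).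
Proof. exact: fam_predP (fam_valP x). Qed.

Lemma fam_complete (F : set_system fam) :
  ProperFilter F -> cauchy F -> cvg F.
Proof.
move=> FF /cauchy_ballP Fc.
have Fe (r : K) : 0 < r ->
    exists A : set fam, F A /\ forall y z : fam, A y -> A z -> `|y - z| < r.
  move=> r0; have [[A B] /= [FA FB] AB] := Fc _ r0.
  exists (A `&` B); split; first exact: filterI.
  move=> y z [Ay _] [_ Bz]; have := AB (y, z) (conj Ay Bz).
  by rewrite -ball_normE.
have Fi i : exists l : X, (fun y : fam => y i) @ F --> l.
  apply/cvg_ex; apply: cauchy_cvg; apply: cauchy_exP => r /Fe[A [FA HA]].
  have [y Ay] := filter_ex FA; exists (y i).
  change (F [set z : fam | ball (y i) r (z i)]); apply: filterS FA => z Az /=.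
  rewrite -ball_normE/=; apply: le_lt_trans (HA _ _ Ay Az).
  exact: (fam_norm_ge1 (y - z) i).
have [x xF] := choice Fi.
have xA (r : K) (A : set fam) : (forall y z : fam, A y -> A z -> `|y - z| < r) ->
    F A -> forall (y : fam) (H : {fset I}), A y ->
    `|\sum_(i <- H) `|y i - x i| *: e i| <= r.
  move=> HA FA y H Ay; apply/ler_addgt0Pl => d d0.
  pose d' := d / (#|` H|%:R + 1).
  have d'0 : 0 < d' by rewrite divr_gt0// ltr_wpDl.
  have FH : F [set z : fam | forall i, i \in H -> `|x i - z i| < d'].
    have : \forall z \near F, {in H, forall i, `|x i - (z : fam) i| < d'}.
      suff : forall s : seq I,
          \forall z \near F, {in s, forall i, `|x i - (z : fam) i| < d'}.
        by exact.
      elim=> [|i s IH]; first by apply: nearW.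
      have /cvgrPdist_lt/(_ _ d'0) Hi := xF i.
      apply: filterS2 IH Hi => z Hs Hi j; rewrite inE => /orP[/eqP->//|].
      exact: Hs.
    exact.
  have [z [Hz Az]] := filter_ex (filterI FH FA).
  have le1 : `|\sum_(i <- H) `|y i - x i| *: e i| <=
      `|\sum_(i <- H) (`|y i - z i| + `|x i - z i|) *: e i|.
    apply: solid_le => i; rewrite normr_ge0/= (distrC (x i)).
    by rewrite (le_trans _ (ler_normD _ _))// subrKA.
  rewrite (le_trans le1)//.
  under eq_bigr do rewrite scalerDl.
  rewrite big_split/= (le_trans (ler_normD _ _))// addrC lerD//; last first.
    apply/ltW/(le_lt_trans _ (HA _ _ Ay Az)).
    exact: (fam_norm_ge (y - z) H).
  rewrite (le_trans (ler_norm_sum _ _ _))//.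
  apply: (@le_trans _ _ (\sum_(i <- H) d')).
    rewrite big_seq [leRHS]big_seq; apply: ler_sum => i iH.
    by rewrite normrZ solid_norm1 mulr1 normr_id ltW// Hz.
  rewrite big_const_seq count_predT iter_addr_0 -mulr_natl /d' mulrCA.
  by rewrite ger_pMr// ler_pdivrMr ?ltr_wpDl// mul1r lerDl.
have xP : fam_pred x.
  apply/asboolP/usum_to_cauchy => r r0.
  have r20 : 0 < r / 2 by rewrite divr_gt0.
  have [A [FA HA]] := Fe _ r20; have [y Ay] := filter_ex FA.
  have [G HG] := usum_to_tail (@fam_usum y) r20; exists G => H GH.
  apply: (@le_lt_trans _ _
      `|\sum_(i <- H) (`|y i| + `|y i - x i|) *: e i|).
    apply: solid_le => i; rewrite normr_ge0/= distrC.
    by rewrite (le_trans _ (ler_normD _ _))// subrKC.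
  under eq_bigr do rewrite scalerDl.
  rewrite big_split/= (le_lt_trans (ler_normD _ _))// [ltRHS]splitr.
  by rewrite ltr_leD ?HG// (xA _ A).
apply/cvg_ex; exists (Fam xP); apply/cvgrPdist_le => r /Fe[A [FA HA]].
apply: filterS (FA) => y Ay; rewrite distrC fam_normE.
apply: usum_to_norm_le (@fam_usum (y - Fam xP)) => H.
by exact: (xA _ A).
Qed.

HB.instance Definition _ := Uniform_isComplete.Build fam fam_complete.

End VectorFamilies.

Section ComplexComplete.
Variable R : realType.
Local Notation C := R[i].

Lemma complex_norm_le (z : C) :
  `|z| <= (`|complex.Re z| + `|complex.Im z|)%:C%C.
Proof.
rewrite {1}(complexE z) (le_trans (ler_normD _ _))// rmorphD/= lerD//.
  by rewrite normc_def /= expr0n addr0 sqrtr_sqr.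
by rewrite normrM normc_def /= expr0n add0r expr1n sqrtr1 mul1r normc_def/= expr0n addr0 sqrtr_sqr.
Qed.

Lemma complex_norm_ge_Im (z : C) : `|complex.Im z|%:C%C <= `|z|.
Proof.
rewrite normc_def lecR -sqrtr_sqr ler_wsqrtr// lerDr sqr_ge0 //.
Qed.

Lemma complex_complete (F : set_system C^o) :
  ProperFilter F -> cauchy F -> cvg F.
Proof.
move=> FF /cauchy_ballP Fc.
have Fpart (f : {additive C -> R}) : (forall z, `|f z|%:C%C <= `|z|) ->
    exists l : R, (f @ F) --> l.
  move=> fle; apply/cvg_ex; apply: R_complete; apply: cauchy_exP => r r0.
  have r0' : 0 < r%:C%C :> C by rewrite ltcR.
  have [[A B] /= [FA FB] AB] := Fc _ r0'.
  have [y [Ay By]] := filter_ex (filterI FA FB).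
  exists (f y); change (F [set z : C^o | ball (f y) r (f z)]).
  apply: filterS FB => z Bz /=; have := AB (y, z) (conj Ay Bz).
  rewrite -!ball_normE/= -raddfB => yz.
  by rewrite -ltcR (le_lt_trans (fle _)).
have [a aF] := Fpart (@complex.Re R) (@normc_ge_Re R).
have [b bF] := Fpart (@complex.Im R) complex_norm_ge_Im.
apply/cvg_ex; exists (a +i* b)%C; apply/cvgrPdist_lt => e.
rewrite ltcE/= => /andP[/eqP ei e0].
have er : e = (complex.Re e)%:C%C by case: e ei {e0} => er ei /= ->.
have e20 : 0 < complex.Re e / 2 by rewrite divr_gt0.
move/cvgrPdist_lt : aF => /(_ _ e20); move/cvgrPdist_lt : bF => /(_ _ e20).
apply: filterS2 => z bz az /=.
rewrite (le_lt_trans (complex_norm_le _))// er ltcR [ltRHS]splitr.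
by case: z az bz => z1 z2 /= az bz; rewrite ltrD.
Qed.

End ComplexComplete.

Variant scalar_kind := RealScalars | ComplexScalars.

Definition scalars (R : realType) (k : scalar_kind) : numFieldType :=
  match k with RealScalars => R | ComplexScalars => R[i] end.

(* The scalar field as a Banach space over itself.                            *)
Definition scalar_line (R : realType) (k : scalar_kind) : Type :=
  (scalars R k)^o.

HB.instance Definition _ R k :=
  NormedModule.copy (scalar_line R k) (scalars R k)^o.

Lemma scalar_line_complete R k (F : set_system (scalar_line R k)) :
  ProperFilter F -> cauchy F -> cvg F.
Proof.
case: k F => F; first exact: (@R_complete R).
exact: (@complex_complete R).
Qed.

HB.instance Definition _ R k :=
  Uniform_isComplete.Build (scalar_line R k) (@scalar_line_complete R k).

(* A normalised unconditional basis for which the norm of V is symmetric; any *)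
(* symmetric basis becomes one after passing to an equivalent norm.           *)
Record symBasis (K : numFieldType) (I : choiceType) (V : normedModType K) :=
  SymBasis {
    basis_vec :> I -> V ;
    basis_norm1 : forall i, `|basis_vec i| = 1 ;
    basis_expansion : forall x : V,
      exists! a : I -> K, usum_to (fun i => a i *: basis_vec i) x ;
    basis_symmetric : forall (p : I -> I) (u a : I -> K) (x : V),
      bijective p -> (forall i, `|u i| = 1) ->
      usum_to (fun i => a i *: basis_vec i) x ->
      exists y : V, usum_to (fun i => (u i * a i) *: basis_vec (p i)) y /\
        `|y| = `|x|
  }.

Section SymmetricSolid.
Context {K : numFieldType} {I : choiceType} {V : normedModType K}.
Variable e : symBasis I V.

Lemma basis_sign (F : {fset I}) (u a : I -> K) : (forall i, `|u i| = 1) ->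
  `|\sum_(i <- F) (u i * a i) *: e i| = `|\sum_(i <- F) a i *: e i|.
Proof.
move=> u1; pose b i := if i \in F then a i else 0.
have bF i : i \in F -> b i = a i by rewrite /b => ->.
have bN i : i \notin F -> b i = 0 by rewrite /b => /negbTE ->.
have bs : usum_to (fun i => b i *: e i) (\sum_(i <- F) b i *: e i).
  by apply: usum_to_finite => i /bN ->; rewrite scale0r.
have idb : bijective (@id I) by exists id.
have [y [ys yE]] := basis_symmetric idb u1 bs.
have us : usum_to (fun i => (u i * b i) *: e i)
    (\sum_(i <- F) (u i * b i) *: e i).
  by apply: usum_to_finite => i /bN ->; rewrite mulr0 scale0r.
have yu : y = \sum_(i <- F) (u i * b i) *: e i.
  by rewrite -(usum_toE ys) (usum_toE us).
transitivity `|y|.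
  by rewrite yu; congr `| _ |; apply: eq_fbigr => i /bF ->.
by rewrite yE; congr `| _ |; apply: eq_fbigr => i /bF ->.
Qed.

Lemma basis_shrink (F : {fset I}) (s : seq I) (c b : I -> K) :
  (forall i, 0 <= c i <= 1) ->
  `|\sum_(i <- F) (if i \in s then c i * b i else b i) *: e i|
    <= `|\sum_(i <- F) b i *: e i|.
Proof.
move=> c01; elim: s => [|j s]; first by under eq_bigr do rewrite in_nil.
apply: le_trans; set b' := fun i => if i \in s then c i * b i else b i.
case: (boolP (j \in s)) => js.
  rewrite le_eqVlt; apply/orP; left; apply/eqP; congr `| _ |.
  by apply: eq_bigr => i _; rewrite inE; case: eqVneq => //= ->; rewrite js.
pose u i : K := if i == j then -1 else 1.
have u1 i : `|u i| = 1 by rewrite /u; case: ifP; rewrite ?normrN1 ?normr1.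
have /andP[c0 c1] := c01 j.
have -> : \sum_(i <- F) (if i \in j :: s then c i * b i else b i) *: e i =
    ((1 + c j) / 2) *: (\sum_(i <- F) b' i *: e i) +
    ((1 - c j) / 2) *: (\sum_(i <- F) (u i * b' i) *: e i).
  rewrite !scaler_sumr -big_split/=; apply: eq_bigr => i _.
  rewrite !scalerA -scalerDl; congr (_ *: _).
  rewrite inE /b' /u; case: eqVneq => [->|_]/=.
    rewrite (negbTE js) mulrA mulrN1 -mulrDl; congr (_ * _).
    by rewrite -mulrBl opprB [1 + _ + _]addrC addrA subrK -mulr2n -(mulr_natr (c j))
      mulfK ?pnatr_eq0.
  rewrite mul1r -mulrDl -mulrDl addrACA subrr addr0.
  by rewrite -[1 + 1]/(2%:R) mulfV ?pnatr_eq0// mul1r.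
rewrite (le_trans (ler_normD _ _))// !normrZ basis_sign//.
rewrite !ger0_norm ?invr_ge0 ?ler0n ?subr_ge0 ?addr_ge0// -mulrDl -mulrDl addrACA.
by rewrite subrr addr0 -[1 + 1]/(2%:R) mulfV ?pnatr_eq0// mul1r.
Qed.

Lemma basis_solid_le (F : {fset I}) (a b : I -> K) :
  (forall i, 0 <= a i <= b i) ->
  `|\sum_(i <- F) a i *: e i| <= `|\sum_(i <- F) b i *: e i|.
Proof.
move=> ab; pose c i := a i / b i.
have b0 i : 0 <= b i by have /andP[/le_trans h /h] := ab i.
have cE i : c i * b i = a i.
  rewrite /c; have [bi0|bi0] := eqVneq (b i) 0; last by rewrite divfK.
  have := ab i; rewrite bi0 => /andP[ai0 ai1].
  by rewrite mulr0; apply/eqP; rewrite eq_sym eq_le ai1.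
have c01 i : 0 <= c i <= 1.
  have /andP[a0 aleb] := ab i; rewrite divr_ge0//=.
  have [bi0|bi0] := eqVneq (b i) 0; first by rewrite /c bi0 invr0 mulr0.
  by rewrite ler_pdivrMr ?mul1r// lt_neqAle eq_sym bi0 b0.
apply: le_trans (basis_shrink F (enum_fset F) b c01).
rewrite le_eqVlt; apply/orP; left; apply/eqP; congr `| _ |.
by apply: eq_fbigr => i iF _; rewrite iF cE.
Qed.

Definition basis_solid : solidSys I V :=
  SolidSys (@basis_norm1 _ _ _ e) basis_solid_le.

End SymmetricSolid.

Definition Esum (K : numFieldType) (I : choiceType)
    (V : completeNormedModType K) (e : symBasis I V)
    (X : completeNormedModType K) : completeNormedModType K :=
  fam (basis_solid e) X.

Section EllOne.
Variables (R : realType) (k : scalar_kind) (I : choiceType).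
Local Notation K := (scalars R k).
Local Notation S := (scalar_line R k).

Definition one_vec (i : I) : S := (1 : K).

Lemma one_vec_norm1 i : `|one_vec i| = 1.
Proof. exact: (@normr1 K). Qed.

Lemma one_vec_sum (F : {fset I}) (a : I -> K) : (forall i, 0 <= a i) ->
  `|\sum_(i <- F) a i *: one_vec i| = \sum_(i <- F) a i.
Proof.
move=> a0; have -> : \sum_(i <- F) a i *: one_vec i = (\sum_(i <- F) a i : K).
  by apply: eq_bigr => i _; exact: (@mulr1 K).
by apply: (@ger0_norm K); exact: sumr_ge0.
Qed.

Lemma one_vec_le (F : {fset I}) (a b : I -> K) : (forall i, 0 <= a i <= b i) ->
  `|\sum_(i <- F) a i *: one_vec i| <= `|\sum_(i <- F) b i *: one_vec i|.
Proof.
move=> ab; have a0 i : 0 <= a i by have /andP[] := ab i.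
have b0 i : 0 <= b i by have /andP[/le_trans h /h] := ab i.
by rewrite !one_vec_sum//; apply: ler_sum => i _; have /andP[] := ab i.
Qed.

Definition one_solid : solidSys I S := SolidSys one_vec_norm1 one_vec_le.

(* ell_1(I): the scalar families a for which the sum of the |a i| * 1         *)
(* converges in the scalar field, normed by that sum.                         *)
Definition ell1 : completeNormedModType K := fam one_solid S.

Implicit Types x y : fam one_solid S.

Lemma ell1_norm_le x (c : K) :
  (forall F : {fset I}, \sum_(i <- F) `|x i| <= c) -> `|x| <= c.
Proof.
move=> xc; rewrite fam_normE; apply: usum_to_norm_le (@fam_usum _ _ _ _ _ x).
by move=> F; rewrite one_vec_sum.
Qed.

Lemma ell1_vec_subproof (i : I) :
  fam_pred one_solid (fun j => ((j == i)%:R : K) : S).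
Proof.
apply/asboolP; exists (\sum_(j <- [fset i]%fset)
  `|((j == i)%:R : K) : S| *: one_vec j).
apply: usum_to_finite => j; rewrite inE => /negbTE ->.
by rewrite normr0 scale0r.
Qed.

Definition ell1_vec (i : I) : fam one_solid S := Fam (ell1_vec_subproof i).

Lemma ell1_vec_norm1 i : `|ell1_vec i| = 1.
Proof.
rewrite fam_normE /fam_sum.
rewrite (@usum_toE _ _ _ _ (one_vec i)); first exact: one_vec_norm1.
have := @usum_to_finite K I S (fun j => `|ell1_vec i j| *: one_vec j) [fset i]%fset.
have n1 : `|(1%:R : K) : S| = 1 :> K := @normr1 K.
rewrite big_seq_fset1 /= eqxx n1 scale1r.
by apply=> j; rewrite inE => /negbTE ->; rewrite normr0 scale0r.
Qed.

Lemma fam_sumE (F : {fset I}) (f : I -> fam one_solid S) j :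
  (\sum_(i <- F) f i) j = \sum_(i <- F) f i j.
Proof. by apply: (big_morph (fun x : fam one_solid S => x j)). Qed.

Lemma ell1_combE (F : {fset I}) (a : I -> K) j :
  (\sum_(i <- F) a i *: ell1_vec i) j = if j \in F then a j else 0.
Proof.
rewrite fam_sumE; case: ifPn => jF.
  rewrite (big_fsetD1 j)//= big_seq big1 ?addr0.
    by rewrite [LHS](_ : _ = a j * (j == j)%:R)// eqxx mulr1.
  move=> i; rewrite !inE eq_sym => /andP[/negbTE ji _].
  by rewrite [LHS](_ : _ = a i * (j == i)%:R)// ji mulr0.
rewrite big_seq big1// => i iF.
have /negbTE ji : j != i by apply: contraNneq jF => ->.
by rewrite [LHS](_ : _ = a i * (j == i)%:R)// ji mulr0.
Qed.

Lemma ell1_expand x : usum_to (fun i => (x i : K) *: ell1_vec i) x.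
Proof.
apply/usum_toP => r r0; have r20 : 0 < r / 2 by rewrite divr_gt0.
have [A HA] := usum_to_tail (@fam_usum _ _ _ _ _ x) r20; exists A => B AB.
apply: (@le_lt_trans _ _ (r / 2)); last first.
  by rewrite ltr_pdivrMr// ltr_pMr// ltr1n.
apply: ell1_norm_le => F.
have [_ /ltW] : True /\ `|\sum_(i <- (F `\` B)%fset) `|x i| *: one_vec i| < r / 2.
  split=> //; apply: HA; apply/fdisjointP => i iA; rewrite inE negb_and negbK.
  by rewrite (fsubsetP AB _ iA).
rewrite one_vec_sum//; apply: le_trans.
rewrite le_eqVlt; apply/orP; left; apply/eqP.
have -> : \sum_(i <- (F `\` B)%fset) `|x i| =
  \sum_(i <- (F `\` B)%fset)
    `|(x - \sum_(j <- B) (x j : K) *: ell1_vec j) i|.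
  apply: eq_fbigr => i; rewrite inE => /andP[/negbTE iB _] _.
  by rewrite fam_subE ell1_combE iB subr0.
apply/esym/big_fset_incl; first exact: fsubsetDl.
move=> i iF; rewrite inE iF andbT negbK => iB.
by rewrite fam_subE ell1_combE iB subrr normr0.
Qed.

Lemma ell1_coord (a : I -> K) x :
  usum_to (fun i => a i *: ell1_vec i) x -> a = x.
Proof.
move=> /usum_toP xs; apply/funext => j; apply/esym/eqP.
rewrite -subr_eq0 -normr_le0; apply/ler_addgt0Pl => r /xs[A HA].
rewrite addr0 ltW// (le_lt_trans _ (HA (j |` A)%fset (fsubsetU1 _ _)))//.
have := fam_norm_ge1 (x - \sum_(i <- (j |` A)%fset) a i *: ell1_vec i) j.
by rewrite fam_subE ell1_combE fset1U1.
Qed.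

Lemma ell1_expansion x :
  exists! a : I -> K, usum_to (fun i => a i *: ell1_vec i) x.
Proof.
exists x; split; first exact: ell1_expand.
by move=> a /ell1_coord.
Qed.

Lemma ell1_symmetric (p : I -> I) (u a : I -> K) x :
  bijective p -> (forall i, `|u i| = 1) ->
  usum_to (fun i => a i *: ell1_vec i) x ->
  exists y, usum_to (fun i => (u i * a i) *: ell1_vec (p i)) y /\ `|y| = `|x|.
Proof.
move=> bp u1 /ell1_coord ->; have [q pK qK] := bp.
pose y j : S := u (q j) * (x (q j) : K).
have yx j : `|y j| = `|x (q j)|.
  by rewrite [LHS](@normrM K) u1 mul1r.
have ys : usum_to (fun j => `|y j| *: one_vec j) (fam_sum one_solid x).
  have -> : (fun j => `|y j| *: one_vec j) = (fun j => `|x j| *: one_vec j) \o q.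
    by apply/funext => j /=; rewrite yx.
  by apply: usum_to_bij; [exists p|exact: (@fam_usum _ _ _ _ _ x)].
have yP : fam_pred one_solid y by apply/asboolP; exists (fam_sum one_solid x).
exists (Fam yP); split.
  rewrite (_ : (fun i => _) = (fun j => (y j : K) *: ell1_vec j) \o p).
    exact: (usum_to_bij bp (@ell1_expand (Fam yP))).
  by apply/funext => i /=; rewrite /y pK.
by rewrite !fam_normE /fam_sum (usum_toE ys).
Qed.

Definition ell1_basis : symBasis I ell1 :=
  @SymBasis _ I ell1 ell1_vec ell1_vec_norm1 ell1_expansion ell1_symmetric.

End EllOne.

Definition equivalent_bases (K : numFieldType) (I : choiceType)
    (V W : normedModType K) (e : I -> V) (f : I -> W) : Prop :=
  forall a : I -> K, (exists s, usum_to (fun i => a i *: e i) s) <->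
                     (exists t, usum_to (fun i => a i *: f i) t).

Section BanachSpaceProperties.
Context {K : numFieldType}.
Implicit Types Z X : completeNormedModType K.

(* Bounded operators are rendered as continuous linear maps.                  *)

Definition is_opnorm Z (T : {linear Z -> Z}) (c : K) : Prop :=
  [/\ 0 <= c, forall z, `|T z| <= c * `|z|
    & forall M, 0 <= M -> (forall z, `|T z| <= M * `|z|) -> c <= M].

(* U T V = Id or U (Id - T) V = Id                                            *)
Definition factors Z (T U V : {linear Z -> Z}) : Prop :=
  (forall z, U (T (V z)) = z) \/ (forall z, U (V z - T (V z)) = z).

Definition PFP Z : Prop := forall T : {linear Z -> Z}, continuous T ->
  exists U V : {linear Z -> Z}, [/\ continuous U, continuous V & factors T U V].

Definition constPFP (C : K) Z : Prop :=
  forall T : {linear Z -> Z}, continuous T ->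
  exists U V : {linear Z -> Z}, [/\ continuous U, continuous V, factors T U V
    & exists u v, [/\ is_opnorm U u, is_opnorm V v & u * v <= C]].

Definition UPFP Z : Prop := exists2 C : K, 1 <= C & constPFP C Z.

Definition separable X : Prop := exists2 D : set X, countable D & dense D.

Definition dual X : Type := {f : {linear X -> K^o} | continuous f}.

Definition total_set X (M : set (dual X)) : Prop :=
  forall x : X, (forall f, M f -> sval f x = 0) -> x = 0.

Definition weak X : topologicalType := initial_topology
  (fun x : X => (fun f => sval f x) : {ptws dual X -> K^o}).

Definition weakly_compact X (W : set X) : Prop := @compact (weak X) W.

Definition linear_span X (W : set X) : set X :=
  [set x | exists (n : nat) (a : 'I_n -> K) (w : 'I_n -> X),
    (forall i, W (w i)) /\ x = \sum_i a i *: w i].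

Definition WCG X : Prop :=
  exists2 W : set X, weakly_compact W & closure (linear_span W) = [set: X].

End BanachSpaceProperties.

Definition card_lt T U (A : set T) (B : set U) : Prop :=
  A #<= B /\ ~ (B #<= A).

(* |A| is the least uncountable cardinal.                                     *)
Definition has_card_omega1 T (A : set T) : Prop :=
  ~ countable A /\ forall B : set T, B `<=` A -> ~ countable B -> A #<= B.

Definition card_gt_omega1 (T : Type) : Prop :=
  exists2 A : set T, has_card_omega1 A & card_lt A [set: T].

(* (T, le) is order isomorphic to the initial ordinal kappa = |T|: a          *)
(* well-order all of whose proper initial segments have cardinality < kappa.  *)
Definition initial_well_order (T : eqType) (le : rel T) : Prop :=
  wochoice.well_order le /\
  forall x, card_lt [set y | le y x && (y != x)] [set: T].

Definition cofinal_set T (le : rel T) (C : set T) : Prop :=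
  forall x, exists2 y, C y & le x y.

(* cf(|T|) > omega: no countable subset of the ordinal |T| is cofinal.        *)
Definition cf_gt_omega (T : eqType) : Prop :=
  exists2 le : rel T, initial_well_order le &
    forall C : set T, cofinal_set le C -> ~ countable C.

(* Main.v *)
From HB Require Import structures.
Require Import Defs.
From mathcomp Require Import all_boot all_order all_algebra finmap.
From mathcomp Require Import all_classical all_reals topology normedtype.
From mathcomp Require Import complex ring lra.

(** An operator T on E(Gamma, X) is an infinite matrix of operators on X, with
    entries T_ij.  If some set D of indices with |D| = |Gamma| makes all the
    entries T_ij with i <> j in D vanish, then T compressed to D is diagonal,
    and so is Id - T.  The factorisation property of X then factors the
    identity of X through T_ii or through Id - T_ii, for each i in D.  One of
    the two alternatives, with a common bound on the factors, holds on a subset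
    of D that still has cardinality |Gamma|: the bound is automatic under the
    uniform property, and it is found among countably many integers when
    cf(|Gamma|) > omega (cf_gt_omega_bigcup).  As the basis is symmetric, that
    subset may be relabelled by Gamma without changing norms, and the factors
    assemble into diagonal operators (uniform_factors, diagonal_factors).
    Their norms are at most the common bounds, so the constant of the uniform
    property is inherited.

    The set D is a free set for a set mapping, the one that sends an index to
    the positions of the nonzero entries in its row or in its column.
    - If the basis is not that of l_1, a functional on E(Gamma, X) can exceed a
      given positive threshold on the unit ball of finitely many coordinate
      copies of X only (functional_large_finite).  Testing a row against a countable
      total set shows that the row has countably many nonzero entries
      (row_support_countable).
    - If X is separable, it has a countable total set by the Hahn-Banach
      theorem, and columns are countable too, because elements of E(Gamma, X)
      have countable support.  A graph with countable degrees on an uncountable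
      set has an independent set of full cardinality
      (free_set_locally_countable).
    - In l_1(Gamma, X) with X weakly compactly generated, columns are
      countable: an operator into l_1(Gamma, X) maps a weakly compact set to a
      set that is uniformly small off countably many coordinates
      (weakly_compact_large_countable).
    When only rows, or only columns, are known to be countable, D comes from
    Hajnal's free set theorem: a set mapping with countable values on a set of
    cardinality greater than omega_1 has a free set of full cardinality
    (hajnal_free_set).

    Hajnal's theorem is proved for an uncountable set O with |O| < |Gamma|.  If
    the sets smaller than Gamma are closed under unions indexed by O, a maximal
    family of disjoint free sets indexed by O has a member of full size
    (free_set_ideal).  Otherwise Gamma is a union of an O-indexed chain of
    smaller sets, closed under the set mapping.  A large free set is chosen in
    each layer where the chain grows in cardinality, and it is split into
    pieces labelled by a common set of labels of cardinality greater than |O|.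
    An element reaches only countably many of the labelled pieces in lower
    layers, so for one label the union of its pieces over all layers is free
    (free_set_singular). *)

Set Implicit Arguments.
Unset Strict Implicit.
Unset Printing Implicit Defensive.

Import Order.TTheory GRing.Theory Num.Theory numFieldNormedType.Exports.

Local Open Scope classical_set_scope.
Local Open Scope card_scope.

(** * Cardinal arithmetic *)

(** Comparing cardinals through relations needs neither a default element in
    the target nor an explicit choice of values. *)
Lemma card_le_injrel T U (A : set T) (B : set U) (R : T -> U -> Prop) :
  (forall x, A x -> exists2 y, B y & R x y) ->
  (forall x x' y, A x -> A x' -> R x y -> R x' y -> x = x') -> A #<= B.
Proof.
move=> RB Rinj; have [->|/set0P[x0 Ax0]] := eqVneq A set0; first exact: card_ge0.
have [y0 By0 _] := RB x0 Ax0.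
pose f x := if pselect (A x) is left Ax then sval (cid2 (RB x Ax)) else y0.
have fP x : A x -> B (f x) /\ R x (f x).
  by rewrite /f; case: pselect => // Ax _; case: cid2.
suff [g] : $|{injfun A >-> B}| by exact: inj_card_le.
apply/injfunPex; exists f; first by move=> x /fP[].
move=> x y /set_mem Ax /set_mem Ay fxy; apply: (Rinj _ _ (f x)) => //.
  by have [] := fP x Ax.
by rewrite fxy; have [] := fP y Ay.
Qed.

Lemma card_le_inj T U (A : set T) (B : set U) (f : T -> U) :
  (forall x, A x -> B (f x)) ->
  (forall x y, A x -> A y -> f x = f y -> x = y) -> A #<= B.
Proof.
move=> fB finj; apply: (@card_le_injrel _ _ _ _ (fun x y => y = f x)).
  by move=> x Ax; exists (f x) => //; exact: fB.
by move=> x x' y Ax Ax' -> /finj; exact.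
Qed.

Lemma card_le_surjrel T U (A : set T) (B : set U) (R : U -> T -> Prop) :
  (forall x, A x -> exists2 y, B y & R y x) ->
  (forall x x' y, B y -> R y x -> R y x' -> x = x') -> A #<= B.
Proof.
move=> RB Rfun; apply: (@card_le_injrel _ _ _ _ (fun x y => B y /\ R y x)).
  by move=> x /RB[y By Ryx]; exists y.
by move=> x x' y _ _ [By Ryx] [_ Ryx']; exact: Rfun Ryx Ryx'.
Qed.

Lemma card_le_sub_image T U (A : set T) (B : set U) (f : U -> T) :
  A `<=` f @` B -> A #<= B.
Proof.
move=> Af; apply: (@card_le_surjrel _ _ _ _ (fun y x => f y = x)).
  by move=> x /Af[y By <-]; exists y.
by move=> x x' y _ <- <-.
Qed.

(** The injection witnessing a comparison, as the graph of a partial bijection: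
    it can be composed and glued without subtypes. *)
Lemma card_le_graph T U (A : set T) (B : set U) : A #<= B ->
  exists R : T -> U -> Prop, [/\ forall x, A x -> exists2 y, B y & R x y,
    forall x x' y, R x y -> R x' y -> x = x',
    forall x y y', R x y -> R x y' -> y = y' &
    forall x y, R x y -> A x /\ B y].
Proof.
move=> /card_leP[f].
exists (fun x y => exists a : A, val a = x /\ val (f a) = y); split.
- move=> x Ax; pose a : A := SigSub (mem_set Ax).
  exists (val (f a)); first exact: set_valP.
  by exists a.
- move=> x x' y [a [<- ay]] [b [<- by_]]; congr val.
  apply: (@inj _ _ _ f); rewrite ?inE//.
  by apply: val_inj; rewrite ay.
- by move=> x y y' [a [<- <-]] [b [/val_inj -> <-]].
- by move=> x y [a [<- <-]]; split; exact: set_valP.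
Qed.

Lemma card_le_injfun T U (u0 : U) (A : set T) (B : set U) : A #<= B ->
  exists f : T -> U, (forall x, A x -> B (f x)) /\
    (forall x y, A x -> A y -> f x = f y -> x = y).
Proof.
move=> /card_le_graph[R [RB Ri _ _]].
pose f x := if pselect (A x) is left Ax then sval (cid2 (RB x Ax)) else u0.
have fP x : A x -> B (f x) /\ R x (f x).
  by rewrite /f; case: pselect => // Ax _; case: cid2.
exists f; split; first by move=> x /fP[].
move=> x y Ax Ay fxy; apply: (Ri _ _ (f x)); first by have [] := fP x Ax.
by rewrite fxy; have [] := fP y Ay.
Qed.

(** A maximal graph of a partial injection has full domain or full range, since
    otherwise it could be extended by one more pair. *)
Lemma card_le_total T U (A : set T) (B : set U) : A #<= B \/ B #<= A.
Proof.
pose P (G : set (T * U)) := [/\ forall x y, G (x, y) -> A x /\ B y,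
  forall x y y', G (x, y) -> G (x, y') -> y = y' &
  forall x x' y, G (x, y) -> G (x', y) -> x = x'].
have [F FP Ftot|G [[G1 G2 G3] Gmax]] := @Zorn_bigcup _ P.
  have F2 p q : (\bigcup_(X in F) X) p -> (\bigcup_(X in F) X) q ->
      exists2 X, F X & X p /\ X q.
    move=> [X FX Xp] [Y FY Yq]; have [XY|YX] := Ftot _ _ FX FY.
      by exists Y => //; split=> //; exact: XY.
    by exists X => //; split=> //; exact: YX.
  split.
  - by move=> x y [X /FP[h _ _] /h].
  - by move=> x y y' /F2/[apply] -[X /FP[_ h _] [/h/[apply]]].
  - by move=> x x' y /F2/[apply] -[X /FP[_ _ h] [/h/[apply]]].
have [AG|] := pselect (forall x, A x -> exists y, G (x, y)).
  left; apply: (@card_le_injrel _ _ _ _ (fun x y => G (x, y))).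
    by move=> x /AG[y Gxy]; exists y => //; have [] := G1 _ _ Gxy.
  by move=> x x' y _ _; exact: G3.
move=> /existsNP[x /not_implyP[Ax /forallNP Gx]]; right.
have [BG|] := pselect (forall y, B y -> exists x, G (x, y)).
  apply: (@card_le_injrel _ _ _ _ (fun y x => G (x, y))).
    by move=> y /BG[z Gzy]; exists z => //; have [] := G1 _ _ Gzy.
  by move=> y y' z _ _; exact: G2.
move=> /existsNP[y /not_implyP[By /forallNP Gy]]; exfalso.
apply: (Gmax (G `|` [set (x, y)])).
  split; first by left.
  by move=> /(_ (x, y)) h; apply: (Gx y); apply: h; right.
split.
- by move=> x' y' [/G1//|[-> ->]].
- move=> x1 y1 y2 [g1|[-> ->]] [g2|]; first exact: G2 g1 g2.
  + by move=> [ex ey]; case: (Gx y1); rewrite -ex.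
  + by case: (Gx y2).
  + by move=> [->].
- move=> x1 x2 y1 [g1|[-> ->]] [g2|]; first exact: G3 g1 g2.
  + by move=> [ex ey]; case: (Gy x1); rewrite -ey.
  + by case: (Gy x2).
  + by move=> [->].
Qed.

Lemma card_le_setX T T' U U' (A : set T) (B : set U) (A' : set T') (B' : set U') :
  A #<= A' -> B #<= B' -> A `*` B #<= A' `*` B'.
Proof.
move=> /card_le_graph[R [R1 R2 _ _]] /card_le_graph[S [S1 S2 _ _]].
apply: (@card_le_injrel _ _ _ _ (fun p q => R p.1 q.1 /\ S p.2 q.2)).
  by move=> [x y] /= [/R1[x' ? ?] /S1[y' ? ?]]; exists (x', y').
move=> [x y] [x' y'] [u v] _ _ /= [xu yv] [xu' yv'].
by rewrite (R2 _ _ _ xu xu') (S2 _ _ _ yv yv').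
Qed.

(** Send x to (i, y), where x lies in F i and y is its image under the injection
    of F i into K: the index i need not be chosen canonically, because the
    second component is injective once i is known. *)
Lemma card_le_bigcup I T U (D : set I) (F : I -> set T) (K : set U) :
  (forall i, D i -> F i #<= K) -> \bigcup_(i in D) F i #<= D `*` K.
Proof.
move=> FK; pose R i : T -> U -> Prop :=
  if pselect (D i) is left Di then sval (cid (card_le_graph (FK i Di))) else fun _ _ => True.
have RP i : D i -> [/\ forall x, F i x -> exists2 y, K y & R i x y,
    forall x x' y, R i x y -> R i x' y -> x = x',
    forall x y y', R i x y -> R i x y' -> y = y' &
    forall x y, R i x y -> F i x /\ K y].
  by rewrite /R; case: pselect => // Di _; case: cid.
apply: (@card_le_injrel _ _ _ _ (fun x p => D p.1 /\ R p.1 x p.2)).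
  by move=> x [i Di Fix]; have [/(_ x Fix)[y Ky Rxy] _ _ _] := RP i Di; exists (i, y).
by move=> x x' [i y] _ _ /= [Di xy] [_ x'y]; have [_ h _ _] := RP i Di; exact: h xy x'y.
Qed.

(** Take a maximal injection B x B -> B, B a subset of A, that extends one on a
    countably infinite subset of A.  If A \ B embeds in B, then A embeds in
    B x B, hence in B, so A x A embeds in B x B and then in A.  If not, A \ B
    contains a copy C of B, and the injection extends to (B u C) x (B u C) by coding the new
    pairs in C: three distinct codes in B tell which components lie in C. *)
Lemma card_le_square T (A : set T) : infinite_set A -> A `*` A #<= A.
Proof.
move=> /infiniteP; have [->|/set0P[t0 At0]] := eqVneq A set0.
  by move=> _; rewrite setX0; exact: card_ge0.
move=> /(card_le_injfun t0)[i [iA iinj]].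
pose G0 : set ((T * T) * T) :=
  [set q | exists m n : nat, q = ((i m, i n), i (choice.pickle (m, n)))].
pose fld (H : set ((T * T) * T)) x := exists z, H ((x, x), z).
pose Q (H : set ((T * T) * T)) := [/\
   forall p z z', H (p, z) -> H (p, z') -> z = z',
   forall p p' z, H (p, z) -> H (p', z) -> p = p',
   forall x y z, H ((x, y), z) -> [/\ fld H x, fld H y & fld H z],
   forall x y, fld H x -> fld H y -> exists z, H ((x, y), z) &
   fld H `<=` A].
have G0f x : fld G0 x <-> exists n, x = i n.
  split; first by move=> [z [m [n [-> _ _]]]]; exists m.
  by move=> [n ->]; exists (i (choice.pickle (n, n))), n, n.
have QG0 : Q G0.
  split.
  - move=> _ z z' [m [n [-> ->]]] [m' [n' [/iinj + /iinj + ->]]].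
    by move=> /(_ I I) -> /(_ I I) ->.
  - move=> p p' z [m [n [-> ->]]] [m' [n' [-> /iinj]]].
    by move=> /(_ I I)/(pcan_inj (@choice.pickleK _)) [-> ->].
  - move=> x y z [m [n [-> -> ->]]]; split; apply/G0f; [by exists m|by exists n|].
    by eexists.
  - move=> x y /G0f[m ->] /G0f[n ->]; exists (i (choice.pickle (m, n))).
    by exists m, n.
  - by move=> x /G0f[n ->]; exact: iA.
(* Adjoining G0 makes the condition hold for the empty chain as well. *)
pose P H := Q (H `|` G0).
have [F FP Ftot|G' [QG Gmax]] := @Zorn_bigcup _ P.
  pose HF := (\bigcup_(X in F) X) `|` G0.
  have F1 p : HF p -> exists X, [/\ Q (X `|` G0), X `|` G0 `<=` HF & (X `|` G0) p].
    move=> [[X FX Xp]|G0p].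
      exists X; split; [exact: FP| |by left].
      by move=> q [Xq|G0q]; [left; exists X|right].
    exists set0; rewrite set0U; split=> //.
    by move=> q; right.
  have F2 p q : HF p -> HF q ->
      exists X, [/\ Q (X `|` G0), X `|` G0 `<=` HF, (X `|` G0) p & (X `|` G0) q].
    have sub X : F X -> X `|` G0 `<=` HF.
      by move=> FX r [Xr|]; [left; exists X|right].
    move=> [[X FX Xp]|G0p] [[Y FY Yq]|G0q].
    - have [XY|YX] := Ftot _ _ FX FY.
        by exists Y; split; [exact: FP|exact: sub|left; exact: XY|left].
      by exists X; split; [exact: FP|exact: sub|left|left; exact: YX].
    - by exists X; split; [exact: FP|exact: sub|left|right].
    - by exists Y; split; [exact: FP|exact: sub|right|left].
    - have [X [qX sX Xp]] := F1 p (or_intror G0p).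
      by exists X; split => //; right.
  have fldS (X Y : set ((T * T) * T)) x : X `<=` Y -> fld X x -> fld Y x.
    by move=> XY [z Xz]; exists z; exact: XY.
  split.
  - by move=> p z z' /F2/[apply] -[X [[h _ _ _ _] _ /h/[apply]]].
  - by move=> p p' z /F2/[apply] -[X [[_ h _ _ _] _ /h/[apply]]].
  - move=> x y z /F1[X [[_ _ h _ _] s /h[h1 h2 h3]]].
    by split; apply: fldS s _.
  - move=> x y [z1 /F2 h] [z2 /h[X [[_ _ _ h' _] s Xx Xy]]].
    have [z Xz] : exists z, (X `|` G0) ((x, y), z).
      by apply: h'; [exists z1|exists z2].
    by exists z; exact: s.
  - by move=> x [z /F1[X [[_ _ _ _ h] s Xx]]]; apply: h; exists z.
pose G := G' `|` G0; pose B := fld G.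
have [g1 g2 g3 g4 g5] := QG; rewrite -/G in g1 g2 g3 g4 g5.
have BB : B `*` B #<= B.
  apply: (@card_le_injrel _ _ _ _ (fun p z => G (p, z))).
    move=> [x y] /= [/g4 h /h[z Gz]]; exists z => //.
    by have [] := g3 _ _ _ Gz.
  by move=> p p' z _ _; exact: g2.
have iB n : B (i n).
  by exists (i (choice.pickle (n, n))); right; exists n, n.
have [p [pB pinj]] : exists p : T * T -> T, (forall q, (B `*` B) q -> B (p q)) /\
    (forall q q', (B `*` B) q -> (B `*` B) q' -> p q = p q' -> q = q').
  exact: (card_le_injfun (i 0)) BB.
have [AB|BA] := card_le_total (A `\` B) B.
  have AleB : A #<= B.
    have [f [fB finj]] := card_le_injfun (i 0) AB.
    have Bi n x : B x -> (B `*` B) (i n, x) by split=> //; exact: iB.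
    apply: (@card_le_inj _ _ _ _
      (fun x => if `[< B x >] then p (i 0, x) else p (i 1%N, f x))).
      by move=> x Ax; case: asboolP => Bx; apply/pB/Bi => //; exact: fB.
    have fB' x : A x -> ~ B x -> B (f x) by move=> Ax Bx; exact: fB.
    move=> x y Ax Ay; case: asboolP => Bx; case: asboolP => By e.
    - by have [] := pinj _ _ (Bi _ _ Bx) (Bi _ _ By) e.
    - have [] := pinj _ _ (Bi _ _ Bx) (Bi _ _ (fB' _ Ay By)) e.
      by move=> /iinj -/(_ I I).
    - have [] := pinj _ _ (Bi _ _ (fB' _ Ax Bx)) (Bi _ _ By) e.
      by move=> /iinj -/(_ I I).
    - have [] := pinj _ _ (Bi _ _ (fB' _ Ax Bx)) (Bi _ _ (fB' _ Ay By)) e.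
      by move=> /finj; apply.
  have BsubA : B #<= A by apply: subset_card_le.
  apply: card_le_trans (card_le_trans BB BsubA); exact: card_le_setX.
exfalso; have [f [fAB finj]] := card_le_injfun (i 0) BA.
pose C := f @` B.
have CA x : C x -> A x by move=> [y By <-]; have [] := fAB y By.
have CB x : C x -> ~ B x by move=> [y By <-]; have [] := fAB y By.
have [h hP] : exists h : T -> T, forall x, C x -> B (h x) /\ f (h x) = x.
  pose h x := if pselect (C x) is left Cx then sval (cid2 Cx) else i 0.
  by exists h => x Cx; rewrite /h; case: pselect => // Cx'; case: cid2.
pose r x := if `[< C x >] then h x else x.
(* The code of a pair records which of its components lie in C. *)
pose k x y : nat := (if `[< C x >] then 1 else 0) + (if `[< C y >] then 2 else 0).
have rB x : B x \/ C x -> B (r x).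
  by rewrite /r; case: asboolP => [Cx|nC]; [case: (hP x Cx)|case].
have rk x x' y y' : B x \/ C x -> B x' \/ C x' -> B y \/ C y -> B y' \/ C y' ->
    k x y = k x' y' -> r x = r x' -> r y = r y' -> (x, y) = (x', y').
  have rinj u v : (C u <-> C v) -> r u = r v -> u = v.
    move=> [uv vu]; rewrite /r; case: asboolP => Cu; case: asboolP => Cv //.
    - by move=> huv; have [_ <-] := hP u Cu; have [_ <-] := hP v Cv; rewrite huv.
    - by have := uv Cu.
    - by have := vu Cv.
  move=> _ _ _ _ kk rx ry; congr (_, _); apply: rinj => //; move: kk; rewrite /k.
    by case: asboolP => ?; case: asboolP => ?; case: asboolP => ?; case: asboolP => ?.
  by case: asboolP => ?; case: asboolP => ?; case: asboolP => ?; case: asboolP => ?.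
pose N : set ((T * T) * T) := [set q | exists x y, [/\ B x \/ C x, B y \/ C y,
   C x \/ C y & q = ((x, y), f (p (i (k x y), p (r x, r y))))]].
have NC x y z : N ((x, y), z) -> C z /\ (C x \/ C y).
  move=> [x' [y' [Bx By xy [-> -> ->]]]]; split => //.
  exists (p (i (k x' y'), p (r x', r y'))) => //.
  by apply: (pB); split=> /=; [exact: iB|apply: pB; split; exact: rB].
have GB x y z : G ((x, y), z) -> [/\ B x, B y & B z] by exact: g3.
have GN x y z z' : G ((x, y), z) -> N ((x, y), z') -> False.
  by move=> /GB[Bx By _] /NC[_ [/CB|/CB]].
have fldN x : fld (G `|` N) x <-> B x \/ C x.
  split.
    move=> [z [/GB[Bx _ _]|[x' [y' [Bx _ _ [-> _ _]]]]]] //; by left.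
  move=> [[z Gz]|Cx]; first by exists z; left.
  by eexists; right; exists x, x; split; [right|right|left|reflexivity].
have QGN : Q (G `|` N).
  split.
  - move=> [x y] z z' [Gz|Nz] [Gz'|Nz'].
    + exact: g1 Gz Gz'.
    + by case: (GN _ _ _ _ Gz Nz').
    + by case: (GN _ _ _ _ Gz' Nz).
    + by move: Nz Nz' => [x1 [y1 [_ _ _ [-> -> ->]]]] [x2 [y2 [_ _ _ [-> -> ->]]]].
  - move=> [x y] [x' y'] z [Gz|Nz] [Gz'|Nz'].
    + exact: g2 Gz Gz'.
    + by have [/CB + _] := NC _ _ _ Nz'; have [_ _ Bz] := GB _ _ _ Gz.
    + by have [/CB + _] := NC _ _ _ Nz; have [_ _ Bz] := GB _ _ _ Gz'.
    + move: Nz Nz' => [x1 [y1 [Bx1 By1 _ [-> -> ->]]]] [x2 [y2 [Bx2 By2 _ [-> ->]]]].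
      have hB u v : B u \/ C u -> B v \/ C v -> (B `*` B) (r u, r v).
        by move=> /rB ? /rB.
      have hB' u v : B u \/ C u -> B v \/ C v -> (B `*` B) (i (k u v), p (r u, r v)).
        by move=> Bu Bv; split; [exact: iB|apply: pB; exact: hB].
      move=> e; have {}e := finj _ _ (pB _ (hB' _ _ Bx1 By1)) (pB _ (hB' _ _ Bx2 By2)) e.
      have [{e}] := pinj _ _ (hB' _ _ Bx1 By1) (hB' _ _ Bx2 By2) e.
      move=> /iinj -/(_ I I) ek e.
      have [{e}] := pinj _ _ (hB _ _ Bx1 By1) (hB _ _ Bx2 By2) e.
      by move=> e1 e2; apply: rk.
  - move=> x y z [Gz|Nz].
      by have [Bx By Bz] := GB _ _ _ Gz; split; apply/fldN; left.
    have [Cz _] := NC _ _ _ Nz; move: Nz => [x' [y' [Bx By _ [-> -> _]]]].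
    by split; apply/fldN => //; right.
  - move=> x y /fldN Bx /fldN By.
    have [Cx|nCx] := pselect (C x).
      by eexists; right; exists x, y; split; [| |left|reflexivity].
    have [Cy|nCy] := pselect (C y).
      by eexists; right; exists x, y; split; [| |right|reflexivity].
    case: Bx => // Bx; case: By => // By.
    by have [z Gz] := g4 x y Bx By; exists z; left.
  - by move=> x /fldN[/g5|/CA].
apply: (Gmax (G `|` N)).
  split; first by move=> q G'q; left; left.
  have Cf : C (f (i 0)) by exists (i 0).
  set c := f (i 0) in Cf *; pose z := f (p (i (k c c), p (r c, r c))).
  move=> /(_ ((c, c), z)) H; have : G ((c, c), z).
    by left; apply: H; right; exists c, c; split => //; [right|right|left].
  by move=> /GB[/(CB _ Cf)].
(* G already contains G0, so adjoining G0 changes nothing. *)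
have -> // : P (G `|` N) = Q (G `|` N).
congr Q; apply/seteqP; split; last by left.
by move=> q [//|G0q]; left; right.
Qed.

Lemma card_le_setX_absorb T U V (A : set T) (B : set U) (K : set V) : infinite_set K ->
  A #<= K -> B #<= K -> A `*` B #<= K.
Proof.
move=> Ki AK BK; apply: card_le_trans (card_le_square Ki); exact: card_le_setX.
Qed.

Lemma card_le_bigcup_absorb I T V (D : set I) (F : I -> set T) (K : set V) :
  infinite_set K -> D #<= K -> (forall i, D i -> F i #<= K) ->
  \bigcup_(i in D) F i #<= K.
Proof.
move=> Ki DK FK; apply: card_le_trans (card_le_bigcup FK) _.
exact: card_le_setX_absorb.
Qed.

Lemma countable_card_le T V (A : set T) (K : set V) :
  infinite_set K -> countable A -> A #<= K.
Proof. by move=> /infiniteP nK cA; exact: card_le_trans cA nK. Qed.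

Lemma card_le_setU_absorb T V (A B : set T) (K : set V) :
  infinite_set K -> A #<= K -> B #<= K -> A `|` B #<= K.
Proof.
move=> Ki AK BK; rewrite -bigcup2E; apply: card_le_bigcup_absorb => //.
  by apply: countable_card_le => //; exact: countableP.
by case=> [|[|n]] _ //=; exact: card_ge0.
Qed.

(** The larger of the two sets absorbs the smaller one. *)
Lemma card_le_split T (A B : set T) : infinite_set [set: T] ->
  [set: T] #<= A `|` B -> [set: T] #<= A \/ [set: T] #<= B.
Proof.
move=> Tinf TAB.
have ABinf : infinite_set (A `|` B) by move=> /(card_le_finite TAB).
have [AB|BA] := card_le_total A B; [right|left];
  apply: card_le_trans TAB _; apply: card_le_setU_absorb => //.
- by move=> Bf; apply: ABinf; rewrite finite_setU; split=> //; exact: card_le_finite AB Bf.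
- by move=> Af; apply: ABinf; rewrite finite_setU; split=> //; exact: card_le_finite BA Af.
Qed.

(** * Well-orders and cofinality *)

(** The strict part of a boolean well-order, in the form needed for well-founded
    recursion. *)
Lemma well_order_strict (T : eqType) (R : rel T) : wochoice.well_order R ->
  let lt x y := R x y /\ x <> y in
  [/\ well_founded lt, forall x y z, lt x y -> lt y z -> lt x z &
      forall x y, [\/ lt x y, x = y | lt y x]].
Proof.
move=> Rwo lt.
have Rmin (A : T -> Prop) : (exists x, A x) ->
    exists x, A x /\ forall y, A y -> R x y.
  move=> [x Ax].
  have [|z [[/asboolP Az zmin] _]] := Rwo (fun x => `[< A x >]).
    by exists x; apply/asboolP.
  by exists z; split=> // y Ay; apply: zmin; apply/asboolP.
have woT : wochoice.wo_chain R predT by move=> A _; exact: Rwo.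
have Rtot x y : R x y || R y x by exact: (wochoice.wo_chainW woT).
have Ranti x y : R x y -> R y x -> x = y.
  by move=> xy yx; apply: (wochoice.wo_chain_antisymmetric woT) => //; apply/andP.
have Rtr x y z : R x y -> R y z -> R x z.
  move=> xy yz; have [|u [ux umin]] := Rmin [set x; y; z].
    by exists x; left; left.
  have ux' := umin x (or_introl (or_introl erefl)).
  have uy' := umin y (or_introl (or_intror erefl)).
  have uz' := umin z (or_intror erefl).
  case: ux => [[]|] e; rewrite e in ux' uy' uz' => //.
    by rewrite (Ranti _ _ xy ux').
  by rewrite (Ranti _ _ yz uy') in xy.
split.
- move=> x; apply: contrapT => nx.
  have [|z [nz zmin]] := Rmin (fun x => ~ Acc lt x).
    by exists x.
  apply: nz; constructor => y [yz ne]; apply: contrapT => /zmin zy.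
  by apply: ne; exact: Ranti.
- move=> x y z [xy nxy] [yz nyz]; split; first exact: Rtr yz.
  by move=> e; rewrite -e in yz; apply: nxy; exact: Ranti.
- move=> x y; have [->|ne] := pselect (x = y); first by constructor 2.
  have /orP[xy|yx] := Rtot x y; first by constructor 1.
  by constructor 3; split=> // /esym.
Qed.

Lemma strict_well_order_exists (T : Type) : exists lt : T -> T -> Prop,
  [/\ well_founded lt, forall x y z, lt x y -> lt y z -> lt x z &
      forall x y, [\/ lt x y, x = y | lt y x]].
Proof.
elim/Peq : T => T; have [R Rwo] := wochoice.well_ordering_principle T.
by exists (fun x y => R x y /\ x <> y); exact: well_order_strict.
Qed.

(** Well-founded recursion picks for each x an element of A not picked before x:
    one remains as long as A does not embed in the initial segment of x. *)
Lemma card_le_initial_segments T U (lt : T -> T -> Prop) (A : set U) :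
  well_founded lt -> (forall x y, [\/ lt x y, x = y | lt y x]) ->
  (forall x, ~ (A #<= [set y | lt y x])) -> [set: T] #<= A.
Proof.
move=> wf lt3 nA.
have [U0|/forallNP nU] := pselect (exists u : U, True); last first.
  have -> : [set: T] = set0; last exact: card_ge0.
  rewrite -subset0 => x _; apply: (nA x).
  have -> : A = set0; last exact: card_ge0.
  by rewrite -subset0 => u _; apply: (nU u).
have [u0 _] := U0.
pose next (B : set U) : U :=
  if pselect (exists u, (A `\` B) u) is left h then sval (cid h) else u0.
pose f := Fix wf (fun=> U) (fun x rec => next [set u | exists y (h : lt y x), rec y h = u]).
have fE x : f x = next (f @` [set y | lt y x]).
  rewrite /f Fix_eq; last first.
    move=> {}x g h gh; congr next; apply/funext => u; apply/propext.
    by split=> -[y [yx <-]]; exists y, yx.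
  congr next; apply/seteqP; split=> u.
    by move=> [y [yx <-]]; exists y.
  by move=> [y yx <-]; exists y, yx.
have fP x : A (f x) /\ forall y, lt y x -> f y <> f x.
  have [u Au] : exists u, (A `\` f @` [set y | lt y x]) u.
    apply: contrapT => h; apply: (nA x); apply: (@card_le_sub_image _ _ _ _ f).
    by move=> u Au; apply: contrapT => nu; apply: h; exists u.
  rewrite fE /next; case: pselect => [h|[]]; last by exists u.
  by case: cid => v /= [Av nv]; split=> // y yx fy; apply: nv; exists y.
apply: (@card_le_inj _ _ _ _ f) => [x _|x y _ _ fxy]; first by have [] := fP x.
case: (lt3 x y) => // [xy|yx]; first by have [_ /(_ x xy)] := fP y.
by have [_ /(_ y yx)] := fP x; rewrite fxy.
Qed.

Lemma well_founded_least (T : Type) (lt : T -> T -> Prop) (A : set T) : well_founded lt ->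
  (exists x, A x) -> exists x, A x /\ forall y, lt y x -> ~ A y.
Proof.
move=> wf [x]; elim: (wf x) => {}x _ IH Ax.
have [[y [yx Ay]]|h] := pselect (exists y, lt y x /\ A y).
  exact: IH yx Ay.
by exists x; split=> // y yx Ay; apply: h; exists y.
Qed.

(** If every A n were smaller than T, it would embed in some initial segment of
    the initial well-order.  These countably many segments have a common bound
    z, so the union of the A n would embed in the segment of z, which is smaller
    than T. *)
Lemma cf_gt_omega_bigcup (T : eqType) (A : nat -> set T) :
  ~ countable [set: T] -> cf_gt_omega T -> [set: T] #<= \bigcup_n A n ->
  exists n, [set: T] #<= A n.
Proof.
move=> Tunc [le [lewo leinit] lecf] TA; apply: contrapT => /forallNP sA.
have [wf ltr lt3] := well_order_strict lewo.
set lt := fun x y => _ in wf ltr lt3.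
have segE x : [set y | lt y x] `<=` [set y | le y x && (y != x)].
  by move=> y [yx /eqP ne] /=; rewrite yx ne.
have /choice[x xA] n : exists x, A n #<= [set y | lt y x].
  apply: contrapT => /forallNP h; apply: (sA n).
  exact: (card_le_initial_segments wf lt3 h).
have [z zP] : exists z, forall n, lt (x n) z.
  apply: contrapT => /forallNP h; apply: (lecf (range x)).
    move=> y; have /existsNP[n nxy] := h y; exists (x n); first by exists n.
    case: (lt3 (x n) y) => [/nxy//|->|[]//].
    by apply: (@wochoice.wo_chain_reflexive T le predT) => // B _; exact: lewo.
  exact: card_le_trans (card_image_le _ _) (card_lexx _).
have [_ nseg] := leinit z.
have Az n : A n #<= [set y | lt y z].
  by apply: card_le_trans (xA n) _; apply: subset_card_le => y /= yx; exact: ltr yx (zP n).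
have [zf|zinf] := pselect (finite_set [set y | lt y z]).
  apply: Tunc; apply: card_le_trans TA _; apply: bigcup_countable => // n _.
  exact/finite_set_countable/(card_le_finite (Az n)).
apply: nseg; apply: card_le_trans TA _; apply: card_le_trans (subset_card_le (@segE z)).
by apply: card_le_bigcup_absorb => //; apply: countable_card_le => //; exact: countableP.
Qed.

(** * Free sets of set mappings *)

Section FreeSets.
Context {T : Type}.
Implicit Types (F : T -> set T) (S : set T).

Definition free_set F S := forall x y, S x -> S y -> x <> y -> ~ F x y.

(** Take a maximal family of disjoint free subsets (A i) of D indexed by O.  If
    all of them are in the ideal, so is the union of the sets A i and F (A i),
    and some a in D avoids it.  By maximality a cannot be added to any A i, and
    since a is not in F (A i), the set F a meets each A i.  These are
    uncountably many disjoint sets, while F a is countable. *)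
Lemma free_set_ideal I (O : set I) (J : set (set T)) F (D : set T) :
  ~ countable O -> (forall x, countable (F x)) ->
  (forall A B, A `<=` B -> J B -> J A) ->
  (forall A B, J A -> J B -> J (A `|` B)) ->
  (forall A : I -> set T, (forall i, O i -> J (A i)) -> J (\bigcup_(i in O) A i)) ->
  (forall A, J A -> J (\bigcup_(x in A) F x)) ->
  ~ J D -> exists S, [/\ S `<=` D, free_set F S & ~ J S].
Proof.
move=> Ounc Fc Jsub JU JO JF nJD.
pose P (Q : set (I * T)) := [/\ forall i x, Q (i, x) -> O i /\ D x,
  forall i j x, Q (i, x) -> Q (j, x) -> i = j &
  forall i x y, Q (i, x) -> Q (i, y) -> x <> y -> ~ F x y].
have [X XP Xtot|Q [[Q1 Q2 Q3] Qmax]] := @Zorn_bigcup _ P.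
  have X2 p q : (\bigcup_(Y in X) Y) p -> (\bigcup_(Y in X) Y) q ->
      exists2 Y, X Y & Y p /\ Y q.
    move=> [Y XY Yp] [Z XZ Zq]; have [YZ|ZY] := Xtot _ _ XY XZ.
      by exists Z => //; split=> //; exact: YZ.
    by exists Y => //; split=> //; exact: ZY.
  split.
  - by move=> i x [Y /XP[h _ _] /h].
  - by move=> i j x /X2/[apply] -[Y /XP[_ h _] [/h/[apply]]].
  - by move=> i x y /X2/[apply] -[Y /XP[_ _ h] [/h/[apply]]].
pose A i x := Q (i, x).
have [[i [Oi nJi]]|JA] := pselect (exists i, O i /\ ~ J (A i)).
  exists (A i); split=> //; first by move=> x /Q1[].
  by move=> x y Ax Ay; exact: Q3 Ax Ay.
have {}JA i : O i -> J (A i).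
  by move=> Oi; apply: contrapT => nJ; apply: JA; exists i.
pose B := \bigcup_(i in O) (A i `|` \bigcup_(x in A i) F x).
have JB : J B by apply: JO => i Oi; apply: JU; [exact: JA|exact/JF/JA].
have [a [Da nBa]] : exists a, D a /\ ~ B a.
  by apply: contra_notP nJD => /forallNP h; apply: Jsub JB => a Da;
     apply: contrapT => nBa; apply: (h a).
exfalso; apply: Ounc; apply: card_le_trans (Fc a).
apply: (@card_le_injrel _ _ _ _ (fun i y => A i y /\ F a y)); last first.
  by move=> i j y _ _ [Aiy _] [Ajy _]; exact: Q2 Aiy Ajy.
move=> i Oi; apply: contrapT => nF.
have nAa j : O j -> ~ A j a by move=> Oj Aja; apply: nBa; exists j => //; left.
apply: (Qmax (Q `|` [set (i, a)])).
  split; first by left.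
  by move=> /(_ (i, a)) h; apply: (nAa i Oi); apply: h; right.
split.
- by move=> j x [/Q1//|[-> ->]].
- move=> j k x [qj|[-> ->]] [qk|].
  + exact: Q2 qj qk.
  + by move=> [_ e]; rewrite e in qj; have [/nAa] := Q1 _ _ qj.
  + by have [/nAa] := Q1 _ _ qk.
  + by move=> [->].
- move=> j x y [qx|[-> ->]] [qy|].
  + exact: Q3 qx qy.
  + move=> [ej ey] _; rewrite ej ey in qx * => Fxa; apply: nBa; exists i => //.
    by right; exists x.
  + by move=> _ Fay; apply: nF; exists y.
  + by move=> [->].
Qed.

(** Free sets for a larger mapping are free for the given one, so a countable set
    mapping may be replaced by its reflexive and transitive closure, which is
    again countable. *)
Lemma set_mapping_closure F : (forall x, countable (F x)) ->
  exists G, [/\ forall x, countable (G x), forall x, F x `<=` G x,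
    forall x, G x x & forall x y, G x y -> G y `<=` G x].
Proof.
move=> Fc; pose G := fix G (n : nat) (x : T) : set T :=
  if n is n'.+1 then \bigcup_(y in G n' x) F y else [set x].
have Gc n x : countable (G n x).
  elim: n => [|n IH] /=; first exact: countable1.
  by apply: bigcup_countable.
exists (fun x => \bigcup_n G n x); split.
- by move=> x; apply: bigcup_countable => //; exact: countableP.
- by move=> x y Fxy; exists 1 => //; exists x.
- by move=> x; exists 0.
- move=> x y [n _ Gy] z [m _]; elim: m z => [z /= ->|m IH z /= [u Gu Fuz]].
    by exists n.
  by have [k _ Gk] := IH _ Gu; exists k.+1 => //; exists u.
Qed.

Section Hajnal.
Variables (F : T -> set T) (O : set T).
Hypothesis Fc : forall x, countable (F x).
Hypothesis Fxx : forall x, F x x.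
Hypothesis Ftr : forall x y, F x y -> F y `<=` F x.
Hypothesis Ounc : ~ countable O.
Hypothesis Osmall : ~ ([set: T] #<= O).

Let cl (A : set T) := \bigcup_(x in A) F x.

Let Oinf : infinite_set O.
Proof. by move=> /finite_set_countable. Qed.

Let small (A : set T) := ~ ([set: T] #<= A).

Let small_le (A B : set T) : A #<= B -> small B -> small A.
Proof. by move=> AB Bs TA; apply: Bs; exact: card_le_trans TA AB. Qed.

Let smallU (A B : set T) : small A -> small B -> small (A `|` B).
Proof.
move=> sA sB; have [Oi|fU] := pselect (finite_set (A `|` B)).
  by apply: small_le Osmall; apply: countable_card_le => //; exact: finite_set_countable.
have [Ai|Bi] : infinite_set A \/ infinite_set B.
- apply: contrapT => /not_orP[/contrapT Af /contrapT Bf]; apply: fU.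
  by rewrite finite_setU.
- have [AB|BA] := card_le_total A B; last first.
    by apply: small_le sA; apply: card_le_setU_absorb.
  apply: small_le sB; apply: card_le_setU_absorb => //.
  by move=> Bf; apply: Ai; apply: card_le_finite AB Bf.
- have [AB|BA] := card_le_total A B.
    by apply: small_le sB; apply: card_le_setU_absorb.
  apply: small_le sA; apply: card_le_setU_absorb => //.
  by move=> Af; apply: Bi; apply: card_le_finite BA Af.
Qed.

Let cl_le V (A : set T) (K : set V) : infinite_set K -> A #<= K -> cl A #<= K.
Proof.
by move=> Ki AK; apply: card_le_bigcup_absorb => // x _; exact: countable_card_le.
Qed.

Let small_cl A : small A -> small (cl A).
Proof.
move=> sA; have [Ai|Af] := pselect (finite_set A); last first.
  by apply: small_le sA; apply: cl_le.
apply: small_le Osmall; apply: cl_le => //.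
by apply: countable_card_le => //; exact: finite_set_countable.
Qed.

(** A well-ordered set of labels that behaves like the successor cardinal of O:
    cut a well-order at the first point whose initial segment is larger than
    O. *)
Let exists_successor (lt : T -> T -> Prop) (C0 : set T) : well_founded lt ->
  (forall x y z, lt x y -> lt y z -> lt x z) ->
  ~ (C0 #<= O) -> exists C, [/\ C `<=` C0, ~ (C #<= O) &
    forall x, C x -> C `&` [set y | lt y x] #<= O].
Proof.
move=> wf ltr nC.
have [h|] := pselect (forall x, C0 x -> C0 `&` [set y | lt y x] #<= O).
  by exists C0; split=> // x.
move=> /existsNP[x1 /not_implyP[Cx1 nx1]].
have [|x [[Cx nx] xmin]] :=
    @well_founded_least T lt (fun x => C0 x /\ ~ (C0 `&` [set y | lt y x] #<= O)) wf.
  by exists x1.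
exists (C0 `&` [set y | lt y x]); split=> [y []||] //.
move=> y [Cy yx]; have := xmin y yx; move=> /not_andP[//|/contrapT].
apply: card_le_trans; apply: subset_card_le => z [[Cz _] zy]; split=> //.
Qed.

Section Singular.
Variables (lt : T -> T -> Prop) (A : T -> set T) (O' C : set T).
Hypothesis wf : well_founded lt.
Hypothesis ltr : forall x y z, lt x y -> lt y z -> lt x z.
Hypothesis lt3 : forall x y, [\/ lt x y, x = y | lt y x].
Hypothesis O'O : O' `<=` O.
Hypothesis sC : small C.
Hypothesis CO : ~ (C #<= O).
Hypothesis Cseg : forall x, C x -> C `&` [set y | lt y x] #<= O.
Let U x := \bigcup_(y in O' `&` [set y | lt y x]) A y.
Hypothesis sA : forall x, O' x -> small (A x).
Hypothesis sU : forall x, O' x -> small (U x).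
Hypothesis AT : ~ small (\bigcup_(x in O') A x).

Let V x := cl (U x `|` (C `|` O)).
Let B x := cl (A x `|` (U x `|` (C `|` O))).
Let D x := B x `\` V x.
Let jump x := O' x /\ ~ (B x #<= V x).

Let clS X Y : X `<=` Y -> cl X `<=` cl Y.
Proof. by move=> XY x [y /XY Yy Fyx]; exists y. Qed.

Let sub_cl X : X `<=` cl X.
Proof. by move=> x Xx; exists x. Qed.

Let cl_closed X x y : cl X x -> F x y -> cl X y.
Proof. by move=> [z Xz /Ftr Fzx] /Fzx; exists z. Qed.

Let VB x : V x `<=` B x.
Proof. by apply: clS => y; right. Qed.

Let CV x : C `<=` V x.
Proof. by move=> y Cy; apply: sub_cl; right; left. Qed.

Let OV x : O `<=` V x.
Proof. by move=> y Oy; apply: sub_cl; right; right. Qed.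

Let Vinf x : infinite_set (V x).
Proof. by move=> /(sub_finite_set (@OV x)). Qed.

Let Binf x : infinite_set (B x).
Proof. by move=> /(sub_finite_set (@VB x)) /Vinf. Qed.

Let BV x y : O' x -> lt x y -> B x `<=` V y.
Proof.
move=> O'x xy; apply: clS => z [Az|[[w [O'w wx] Az]|COz]].
- by left; exists x.
- by left; exists w => //; split => //; exact: ltr wx xy.
- by right.
Qed.

Let sB x : O' x -> small (B x).
Proof.
by move=> O'x; apply/small_cl/smallU; [exact: sA|apply: smallU; [exact: sU|exact: smallU]].
Qed.

Let BT : ~ small (\bigcup_(x in O') B x).
Proof.
apply: contra_not AT; apply: small_le; apply: subset_card_le => y [x O'x Axy].
by exists x => //; apply: sub_cl; left.
Qed.

(** The regularity of C: an unbounded family indexed by at most |O| points would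
    cover C by |O| initial segments of cardinality at most |O|. *)
Let bounded (I : set T) (f : T -> T) : I #<= O -> (forall i, I i -> C (f i)) ->
  exists c, C c /\ forall i, I i -> lt (f i) c.
Proof.
move=> IO fC; apply: contrapT => /forallNP h; apply: CO.
have : C `<=` \bigcup_(i in I) ((C `&` [set y | lt y (f i)]) `|` [set f i]).
  move=> c Cc; have := h c; move=> /not_andP[//|/existsNP[i /not_implyP[Ii nic]]].
  exists i => //; case: (lt3 (f i) c) => //; first by right.
  by left.
move=> /subset_card_le/card_le_trans; apply.
apply: card_le_bigcup_absorb => // i Ii; apply: card_le_setU_absorb => //.
  exact/Cseg/fC.
by apply: countable_card_le => //; exact: countable1.
Qed.

(** Otherwise all the B x would embed in the small set B z, and so would their
    union.  At the first x above z where B x outgrows B z, all earlier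
    members of the chain embed in B z, so B x also outgrows V x. *)
Let jump_above z : O' z -> exists x, jump x /\ lt z x.
Proof.
move=> O'z.
have [|x [[O'x zx nxz] xmin]] :=
    @well_founded_least T lt (fun x => [/\ O' x, lt z x & ~ (B x #<= B z)]) wf.
  apply: contrapT => /forallNP h; apply: BT; apply: small_le (sB O'z).
  apply: card_le_bigcup_absorb; first exact: Binf.
    apply: subset_card_le => x /O'O Ox; exact/VB/OV.
  move=> x O'x; case: (lt3 x z) => [xz|->//|zx].
    by apply: subset_card_le; apply: subset_trans (@VB z); exact: BV.
  by apply: contrapT => nxz; apply: (h x).
exists x; split=> //; split=> // BVx; apply: nxz; apply: card_le_trans BVx _.
have : V x `<=` B z `|` \bigcup_(y in O' `&` [set y | lt y x]) B y.
  move=> u [w [[y [O'y yx] Ayw]|COw] Fwu].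
    by right; exists y => //; apply: cl_closed Fwu; apply: sub_cl; left.
  by left; apply: cl_closed Fwu; apply: sub_cl; right; right.
move=> /subset_card_le/card_le_trans; apply.
apply: card_le_setU_absorb => //.
apply: card_le_bigcup_absorb => //.
  by apply: subset_card_le => y [/O'O Oy _]; exact/VB/OV.
move=> y [O'y yx]; case: (lt3 y z) => [yz|->//|zy].
  by apply: subset_card_le; apply: subset_trans (@VB z); exact: BV.
by apply: contrapT => nyz; apply: (xmin y yx).
Qed.

Let block x : exists E, [/\ E `<=` D x, free_set F E & jump x -> ~ (E #<= V x)].
Proof.
have [jx|njx] := pselect (jump x); last by exists set0; split.
have absorb := @card_le_bigcup_absorb _ T T _ _ _ (@Vinf x).
have [|||||E [ED Efree nE]] := @free_set_ideal T O (fun A => A #<= V x) F (D x) Ounc Fc.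
- by move=> X Y XY; apply: card_le_trans; exact: subset_card_le.
- by move=> X Y; exact: card_le_setU_absorb.
- by move=> X XV; apply: absorb => //; exact/subset_card_le/OV.
- by move=> X XV; exact: cl_le.
- have [_ nB] := jx; apply: contra_not nB => DV.
  have : B x `<=` D x `|` V x by move=> y By; have [|] := pselect (V x y); [right|left].
  by move=> /subset_card_le/card_le_trans; apply; exact: card_le_setU_absorb.
by exists E; split.
Qed.

Let E x := sval (cid (block x)).
Let EP x : [/\ E x `<=` D x, free_set F (E x) & jump x -> ~ (E x #<= V x)].
Proof. by rewrite /E; case: cid. Qed.

(** The inductive step, for the layer x; it is applied to the sets hits y of
    labels that F y meets in the lower layers.  A countable set of labels is
    bounded, and there are at most |V x| possible bounds, so one bound v0 serves
    for too many y to embed in V x.  These y are distributed among all the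
    labels, each label receiving as many of them as there are in total, and only
    the labels above v0 are used. *)
Let layer x (hits : T -> set T) : exists P : T -> set T,
  [/\ forall v y, P v y -> [/\ C v, E x y & ~ hits y v],
      forall v w y, P v y -> P w y -> v = w &
      jump x -> (forall y, E x y -> countable (hits y) /\ hits y `<=` C) ->
      exists v0, C v0 /\ forall v, C v -> lt v0 v -> ~ (P v #<= V x)].
Proof.
have [[jx hc]|h] := pselect (jump x /\
    forall y, E x y -> countable (hits y) /\ hits y `<=` C); last first.
  by exists (fun=> set0); split => // jx hc; case: h.
have [_ _ /(_ jx) nEV] := EP x.
have [b bP] : exists b : T -> T, forall y, E x y -> C (b y) /\
    forall v, hits y v -> lt v (b y).
  have h y : exists c, E x y -> C c /\ forall v, hits y v -> lt v c.
    have [Ey|] := pselect (E x y); last by exists y.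
    have [hcy hC] := hc y Ey.
    have [||c [Cc cb]] := @bounded (hits y) id; [exact: countable_card_le|exact: hC|].
    by exists c.
  by have [b hb] := choice h; exists b.
have [b0 [Cb0 nE']] : exists b0, C b0 /\ ~ (E x `&` [set y | b y = b0] #<= V x).
  apply: contrapT => /forallNP h; apply: nEV.
  have : E x `<=` \bigcup_(c in C) (E x `&` [set y | b y = c]).
    by move=> y Ey; exists (b y) => //; have [] := bP y Ey.
  move=> /subset_card_le/card_le_trans; apply.
  apply: card_le_bigcup_absorb => //; first exact/subset_card_le/CV.
  by move=> c Cc; apply: contrapT => nc; apply: (h c).
set E' := E x `&` _ in nE'.
have VE' : V x #<= E' by have [] := card_le_total (V x) E'.
have E'inf : infinite_set E' by move=> /(card_le_finite VE') /Vinf.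
have CE' : C #<= E' by apply: card_le_trans VE'; exact/subset_card_le/CV.
have [y0 _] : exists y, E' y.
  by apply: contrapT => /forallNP h; apply: E'inf; have -> : E' = set0 by rewrite -subset0.
have /(card_le_injfun y0)[g [gE' ginj]] : E' `*` C #<= E' by apply: card_le_setX_absorb.
exists (fun v y => [/\ C v, lt b0 v & exists2 z, E' z & y = g (z, v)]); split.
- move=> v _ [Cv b0v [z E'z ->]].
  have [Eg gb] : E' (g (z, v)) by apply: gE'.
  split=> // hv; have [_ /(_ v hv)] := bP _ Eg; rewrite gb => vb0.
  have := ltr vb0 b0v; elim: (wf v) => u _ IH uu; exact: (IH _ uu uu).
- move=> v w y [Cv _ [z Ez ->]] [Cw _ [z' Ez' e]].
  by have [] := ginj (z, v) (z', w) (conj Ez Cv) (conj Ez' Cw) e.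
- move=> _ _; exists b0; split=> // v Cv b0v PV; apply: nE'; apply: card_le_trans PV.
  apply: (@card_le_inj _ _ _ _ (fun z => g (z, v))).
    by move=> z E'z; split=> //; exists z.
  move=> z z' E'z E'z' e.
  by have [] := ginj (z, v) (z', v) (conj E'z Cv) (conj E'z' Cv) e.
Qed.

(** The pieces P x v are built by recursion on the layer x.  A label s above the
    bounds of all the layers exists, because there are at most |O| layers, and
    the union S of the pieces P x s over the jumps x is free: from an upper layer
    to a lower one by the choice of the labels, inside a layer because E x is
    free, and from a lower layer to an upper one because B x is closed under
    F.  Beyond each B z there is a jump, so S embeds in no B z; hence every B z
    embeds in S, and so does their union. *)
Lemma free_set_singular : exists S, free_set F S /\ [set: T] #<= S.
Proof.
pose G x hits := sval (cid (layer x hits)).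
have GP x hits :
  [/\ forall v y, G x hits v y -> [/\ C v, E x y & ~ hits y v],
      forall v w y, G x hits v y -> G x hits w y -> v = w &
      jump x -> (forall y, E x y -> countable (hits y) /\ hits y `<=` C) ->
      exists v0, C v0 /\ forall v, C v -> lt v0 v -> ~ (G x hits v #<= V x)].
  exact: (svalP (cid (layer x hits))).
(* The labels hit by y are computed from the pieces of the lower layers. *)
pose step x (rec : forall y, lt y x -> T -> set T) := G x (fun y v =>
  C v /\ exists w (h : lt w x), O' w /\ exists2 z, rec w h v z & F y z).
pose P := Fix wf (fun=> T -> set T) step.
pose hits x y : set T := [set v | C v /\ exists w,
  [/\ lt w x, O' w & exists2 z, P w v z & F y z]].
have PE x : P x = G x (hits x).
  rewrite /P Fix_eq; last first.
    move=> {}x f g fg; rewrite /step; congr G; apply/funext => y; apply/funext => v.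
    apply/propext; split=> -[Cv [w [h [O'w [z fz Fyz]]]]];
      by split=> //; exists w, h; split=> //; exists z; rewrite // ?fg // -fg.
  congr G; apply/funext => y; apply/funext => v.
  apply/propext; split=> -[Cv [w]].
    by move=> [h [O'w [z Pz Fyz]]]; split=> //; exists w; split=> //; exists z.
  by move=> [h O'w [z Pz Fyz]]; split=> //; exists w, h; split=> //; exists z.
have P1 x v y : P x v y -> [/\ C v, E x y & ~ hits x y v].
  by rewrite {1}PE; have [h _ _] := GP x (hits x); exact: h.
have P2 x v w y : P x v y -> P x w y -> v = w.
  by rewrite PE; have [_ h _] := GP x (hits x); exact: h.
have ED x : E x `<=` D x by have [] := EP x.
have Dlt x y z : O' x -> lt x y -> D x z -> D y z -> False.
  by move=> O'x xy [Bz _] [_]; apply; exact: BV Bz.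
have Ddis x y z : O' x -> O' y -> D x z -> D y z -> x = y.
  by move=> O'x O'y Dx Dy; case: (lt3 x y) => // xy;
     [case: (Dlt x y z)|case: (Dlt y x z)].
have hitsc x y : countable (hits x y).
  apply: card_le_trans (Fc y).
  apply: (@card_le_injrel _ _ _ _ (fun v z => exists w, [/\ O' w, P w v z & F y z])).
    by move=> v [Cv [w [wx O'w [z Pz Fyz]]]]; exists z => //; exists w.
  move=> v v' z _ _ [w [O'w Pz _]] [w' [O'w' Pz' _]].
  have [_ /ED Dz _] := P1 _ _ _ Pz; have [_ /ED Dz' _] := P1 _ _ _ Pz'.
  have e := Ddis _ _ _ O'w O'w' Dz Dz'; rewrite e in Pz.
  exact: P2 Pz Pz'.
have [v0 v0P] : exists v0 : T -> T, forall x, jump x -> C (v0 x) /\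
    forall v, C v -> lt (v0 x) v -> ~ (P x v #<= V x).
  have h x : exists c, jump x -> C c /\ forall v, C v -> lt c v -> ~ (P x v #<= V x).
    have [jx|] := pselect (jump x); last by exists x.
    have [_ _ /(_ jx)] := GP x (hits x); rewrite -PE => -[|c [Cc cP]].
      by move=> y Ey; split; [exact: hitsc|move=> v []].
    by exists c.
  by have [v0 hv] := choice h; exists v0.
have [||s [Cs sP]] := @bounded jump v0.
- by apply: subset_card_le => x [/O'O].
- by move=> x /v0P[].
pose S := \bigcup_(x in jump) P x s.
exists S; split.
  move=> y z [x jx Py] [w jw Pz] yz Fyz.
  have [_ Ey nhy] := P1 _ _ _ Py; have [_ Ez nhz] := P1 _ _ _ Pz.
  case: (lt3 x w) => [xw|xw|wx].
  - have [_ nVz] := ED _ _ Ez; apply: nVz; apply: (BV jx.1 xw).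
    by apply: cl_closed Fyz; have [] := ED _ _ Ey.
  - rewrite -xw in Ez; have [_ Efree _] := EP x; exact: Efree Fyz.
  - by apply: nhy; split=> //; exists w; split => //; [exact: jw.1|exists z].
have nSB z : O' z -> ~ (S #<= B z).
  move=> O'z SB; have [x [jx zx]] := jump_above O'z.
  have [Cv0 /(_ s Cs (sP x jx))] := v0P x jx; apply.
  apply: (@card_le_trans _ _ _ S).
    by apply: subset_card_le => y Py; exists x.
  by apply: card_le_trans SB _; apply: subset_card_le; exact: BV.
have BS z : O' z -> B z #<= S.
  by move=> /nSB; have [] := card_le_total (B z) S.
have TB : [set: T] #<= \bigcup_(x in O') B x by exact: contrapT.
apply: card_le_trans TB _.
have [[z O'z]|h] := pselect (exists z, O' z); last first.
  have -> : \bigcup_(x in O') B x = set0; last exact: card_ge0.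
  by rewrite -subset0 => y [x O'x]; case: h; exists x.
have OS : O #<= S.
  by apply: card_le_trans (BS z O'z); apply: subset_card_le => y Oy; exact/VB/OV.
apply: card_le_bigcup_absorb => //.
  by move=> Sf; apply: Oinf; exact: card_le_finite OS Sf.
by apply: card_le_trans OS; exact: subset_card_le.
Qed.

End Singular.

(** Either small sets are closed under unions indexed by O, or they are not.  In
    the second case an index set whose proper initial segments have small unions
    is obtained by cutting O at the first segment with a large union. *)
Lemma free_set_closed : exists S, free_set F S /\ [set: T] #<= S.
Proof.
have [JO|nJO] := pselect (forall A : T -> set T, (forall i, O i -> small (A i)) ->
  small (\bigcup_(i in O) A i)).
  have [|||||S [_ Sfree TS]] := @free_set_ideal T O small F setT Ounc Fc.
  - by move=> A B AB; apply: small_le; exact: subset_card_le.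
  - exact: smallU.
  - exact: JO.
  - exact: small_cl.
  - by apply; exact: card_lexx.
  by exists S; split=> //; exact: contrapT.
move: nJO => /existsNP[A /not_implyP[sA nsA]].
have [lt [wf ltr lt3]] := strict_well_order_exists T.
have [i0 [Oi0 ni0]] : exists i, O i /\ ~ (A i #<= O).
  apply: contrapT => /forallNP h; apply: nsA; apply: small_le Osmall.
  apply: card_le_bigcup_absorb => // i Oi; apply: contrapT => ni.
  by apply: (h i).
have [C [CA nCO Cseg]] := exists_successor wf ltr ni0.
have sC : small C by apply: small_le (sA _ Oi0); exact: subset_card_le.
pose U X x := \bigcup_(y in X `&` [set y | lt y x]) A y.
have [sU|] := pselect (forall x, O x -> small (U O x)).
  exact: (@free_set_singular lt A O C).
move=> /existsNP[x1 /not_implyP[Ox1 nx1]].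
have [|x [[Ox nx] xmin]] := @well_founded_least T lt (fun x => O x /\ ~ small (U O x)) wf.
  by exists x1.
apply: (@free_set_singular lt A (O `&` [set y | lt y x]) C wf ltr lt3) => //.
- by move=> y [/sA].
- move=> y [Oy yx]; have /not_andP[//|/contrapT] := xmin y yx.
  apply: small_le; apply: subset_card_le => z [w [[Ow _] wy] Aw].
  by exists w.
Qed.

End Hajnal.

(** Hajnal's free set theorem for set mappings with countable values.  The
    hypotheses on O say that O is uncountable and smaller than T. *)
Theorem hajnal_free_set F (O : set T) : (forall x, countable (F x)) ->
  ~ countable O -> ~ ([set: T] #<= O) ->
  exists S, free_set F S /\ [set: T] #<= S.
Proof.
move=> Fc Ounc Osm; have [G [Gc FG Gxx Gtr]] := set_mapping_closure Fc.
have [S [Sfree TS]] := free_set_closed Gc Gxx Gtr Ounc Osm.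
exists S; split=> // x y Sx Sy xy /FG; exact: Sfree.
Qed.

(** The neighbourhoods of the points of a maximal free set S cover T by
    maximality.  They are countable, so T embeds in S as soon as S is infinite,
    and S is infinite because T is uncountable. *)
Lemma free_set_locally_countable F : ~ countable [set: T] -> (forall x, countable (F x)) ->
  (forall y, countable [set x | F x y]) ->
  exists S, free_set F S /\ [set: T] #<= S.
Proof.
move=> Tunc Fc Fc'.
have [X XF Xtot|S [Sfree Smax]] := @Zorn_bigcup _ (free_set F).
  move=> x y [Y XY Yx] [Z XZ Zy]; have [YZ|ZY] := Xtot _ _ XY XZ.
    by apply: (XF Z) => //; exact: YZ.
  by apply: (XF Y) => //; exact: ZY.
exists S; split=> //.
pose N x := [set x] `|` (F x `|` [set y | F y x]).
have Nc x : countable (N x).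
  have nat_inf : infinite_set [set: nat] by exact: infinite_nat.
  apply: (card_le_setU_absorb nat_inf); first exact: countable1.
  by apply: (card_le_setU_absorb nat_inf); [exact: Fc|exact: Fc'].
have TN : [set: T] `<=` \bigcup_(x in S) N x.
  move=> y _; apply: contrapT => nN.
  have nSN x : S x -> ~ N x y by move=> Sx Nxy; apply: nN; exists x.
  have nSy : ~ S y by move=> Sy; apply: (nSN y Sy); left.
  apply: (Smax (S `|` [set y])).
    by split; [left|move=> /(_ y) h; apply: nSy; apply: h; right].
  move=> u v [Su|->] [Sv|->] // uv Fuv.
  - exact: Sfree Fuv.
  - by apply: (nSN u Su); right; left.
  - by apply: (nSN v Sv); right; right.
apply: card_le_trans (subset_card_le TN) _.
have Sinf : infinite_set S.
  move=> /finite_set_countable Sc; apply: Tunc.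
  by apply: card_le_trans (subset_card_le TN) _; exact: bigcup_countable.
by apply: card_le_bigcup_absorb => // x _; exact: countable_card_le.
Qed.

End FreeSets.

(** A maximal free set S that is finite would be met by F y for all y outside a
    finite set.  Removing S from the values of F then lowers the bound n by one,
    and induction applies to the remaining y. *)
Lemma infinite_free_set (T : choiceType) (n : nat) (A : set T) (F : T -> {fset T}) :
  infinite_set A -> (forall x, A x -> (#|` F x| <= n)%N) ->
  exists S, [/\ S `<=` A, infinite_set S & free_set (fun x => [set` F x]) S].
Proof.
elim: n A F => [|n IH] A F Ainf Fn.
  exists A; split=> // x y Ax _ _ /=.
  by have := Fn x Ax; rewrite leqn0 cardfs_eq0 => /eqP->; rewrite inE.
pose P S := S `<=` A /\ free_set (fun x => [set` F x]) S.
have [G GP Gtot|S [[SA Sfree] Smax]] := @Zorn_bigcup _ P.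
  split; first by move=> x [Y /GP[YA _] /YA].
  move=> x y [Y GY Yx] [Z GZ Zy]; have [YZ|ZY] := Gtot _ _ GY GZ.
    by have [_] := GP _ GZ; apply => //; exact: YZ.
  by have [_] := GP _ GY; apply => //; exact: ZY.
have [Sfin|Sinf] := pselect (finite_set S); last by exists S.
pose N := S `|` \bigcup_(x in S) [set` F x].
have Nfin : finite_set N.
  rewrite /N finite_setU; split=> //; apply: bigcup_finite => // x _; exact: finite_fset.
have [||S' [S'A S'inf S'free]] := IH (A `\` N) (fun y => (F y `\` fset_set S)%fset).
- exact: infinite_setD.
- move=> y [Ay nNy]; have [x Sx Fyx] : exists2 x, S x & x \in F y.
    apply: contrapT => h; apply: (Smax (S `|` [set y])).
      split; first by left.
      by move=> /(_ y) Sy; apply: nNy; left; apply: Sy; right.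
    split; first by move=> z [/SA|->].
    move=> u v [Su|->] [Sv|->] // uv Fuv.
    + exact: Sfree Fuv.
    + by apply: nNy; right; exists u.
    + by apply: h; exists v.
  rewrite -ltnS; apply: leq_trans (Fn y Ay); apply: fproper_ltn_card.
  rewrite fproperE fsubsetDl /=; apply/negP => /fsubsetP/(_ x Fyx).
  by rewrite inE in_fset_set// mem_set.
exists S'; split=> //; first by move=> x /S'A[].
move=> x y S'x S'y xy Fxy; apply: (S'free x y) => //=.
rewrite inE in_fset_set// Fxy andbT; apply/negP => /set_mem Sy.
by have [_] := S'A _ S'y; apply; left.
Qed.

Local Open Scope ring_scope.

(** * Bounded operators and scalars *)

Section LinearTools.
Context {K : numFieldType}.

Lemma linear_exists (U : lmodType K) (V : lmodType K) (f : U -> V) :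
  (forall a u v, f (a *: u + v) = a *: f u + f v) ->
  exists g : {linear U -> V}, forall x, g x = f x.
Proof.
move=> fl; pose g : {linear U -> V} := HB.pack f (GRing.isLinear.Build _ _ _ _ f fl).
by exists g.
Qed.

Lemma bound_continuous (U V : normedModType K) (f : {linear U -> V}) (c : K) :
  (forall x, `|f x| <= c * `|x|) -> continuous f.
Proof.
move=> fc; apply: bounded_linear_continuous; apply/ex_bound; exists `|c|.
apply/nbhs_norm0P; exists 1 => //= x /= x1.
rewrite (le_trans (fc x))//.
have [->|x0] := eqVneq x 0; first by rewrite normr0 mulr0.
have c0 : 0 <= c.
  by rewrite -(@pmulr_lge0 _ `|x|) ?normr_gt0// (le_trans _ (fc x)).
by rewrite ger0_norm// ler_piMr// ltW.
Qed.

Lemma continuous_bound (U V : normedModType K) (f : {linear U -> V}) :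
  continuous f -> exists2 c : K, 0 < c & forall x, `|f x| <= c * `|x|.
Proof.
move=> /(_ 0)/continuous_linear_bounded/linear_boundedP.
by move=> /pinfty_ex_gt0[c c0 fc]; exists c.
Qed.

Lemma sign_exists (a : K) : exists s : K, `|s| = 1 /\ s * a = `|a|.
Proof.
have [->|a0] := eqVneq a 0; first by exists 1; rewrite normr1 mulr0 normr0.
(* The conjugate of the phase of a. *)
exists (`|a| / a); split; last by rewrite divfK.
by rewrite normrM normr_id normfV divff// normr_eq0.
Qed.

End LinearTools.

Section Scalars.
Variables (R : realType) (k : scalar_kind).
Local Notation K := (scalars R k).

Lemma scalars_nat_bound (x : K) : exists n : nat, `|x| <= n%:R.
Proof.
case: k x => /= x.
  by exists (Num.truncn `|x|).+1; rewrite ltW// truncnS_gt.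
exists (Num.truncn (complex.Re `|x|)).+1.
have : `|x| \is Num.real by rewrite normr_real.
move=> /RRe_real <-.
have -> : ((Num.truncn (complex.Re `|x|)).+1%:R : R[i]) =
    ((Num.truncn (complex.Re `|x|)).+1%:R)%:C%C.
  by rewrite rmorph_nat.
by rewrite lecR ltW// truncnS_gt.
Qed.

Lemma scalars_inv_nat (x : K) : x != 0 -> exists n : nat, n.+1%:R^-1 <= `|x|.
Proof.
move=> x0; have [n hn] := scalars_nat_bound x^-1; exists n.
rewrite -[leRHS]invrK lef_pV2 ?posrE ?invr_gt0 ?normr_gt0 ?ltr0Sn// -normfV.
by rewrite (le_trans hn)// ler_nat.
Qed.

(** Infima of sets of nonnegative scalars.  In the complex field the nonnegative
    scalars are the nonnegative reals, so this is the completeness of the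
    reals in both cases. *)
Lemma scalars_inf (A : set K) : (forall a, A a -> 0 <= a) -> (exists a, A a) ->
  exists m, [/\ 0 <= m, forall a, A a -> m <= a &
    forall b, 0 <= b -> (forall a, A a -> b <= a) -> b <= m].
Proof.
case: k A => /= A A0 [a0 Aa0].
  have hA : has_inf A by split; [exists a0|exists 0 => a /A0].
  exists (inf A); split.
  - by apply: lb_le_inf; [exists a0|move=> a /A0].
  - by move=> a Aa; apply: ge_inf => //; exact: hA.2.
  - by move=> b _ bA; apply: lb_le_inf; [exists a0|move=> a /bA].
pose B : set R := [set r | A (r%:C)%C].
have AB a : A a -> exists2 r, a = (r%:C)%C & B r.
  move=> Aa; have /ger0_real/RRe_real ar := A0 a Aa.
  by exists (complex.Re a); rewrite // /B /= ar.
have [b0 _ Bb0] := AB a0 Aa0.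
have B0 r : B r -> 0 <= r by move=> /A0; rewrite ler0c.
exists ((inf B)%:C)%C; split.
- by rewrite ler0c; apply: lb_le_inf; [exists b0|move=> a /B0].
- move=> _ /AB[r -> Br]; rewrite lecR; apply: ge_inf => //.
  by exists 0 => s /B0.
- move=> b b_ge0 bA; have /ger0_real/RRe_real br := b_ge0.
  rewrite -br lecR; apply: lb_le_inf; first by exists b0.
  by move=> r Br; rewrite -lecR br bA.
Qed.

(** The operator norm is the infimum of the bounds. *)
Lemma opnorm_exists (Z : completeNormedModType K) (U : {linear Z -> Z}) (c : K) :
  0 <= c -> (forall z, `|U z| <= c * `|z|) ->
  exists2 u, is_opnorm U u & u <= c.
Proof.
move=> c0 Uc.
have [||m [m0 mA mlb]] := @scalars_inf [set M | 0 <= M /\ forall z, `|U z| <= M * `|z|].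
- by move=> a [].
- by exists c.
exists m; last by apply: mA.
split=> //; last by move=> M M0 UM; apply: mA.
move=> z; have [->|z0] := eqVneq z 0; first by rewrite linear0 !normr0 mulr0.
rewrite -ler_pdivrMr ?normr_gt0//; apply: mlb; first by rewrite divr_ge0.
by move=> M [_ /(_ z)]; rewrite ler_pdivrMr ?normr_gt0.
Qed.

End Scalars.

(** * The Hahn-Banach theorem *)

Section HahnBanachReal.
Variables (R : realType) (K : numFieldType) (iota : {rmorphism R -> K})
  (V : lmodType K) (p : V -> R).
Hypothesis pD : forall x y, p (x + y) <= p x + p y.
Hypothesis pZ : forall r x, 0 <= r -> p (iota r *: x) = r * p x.

Let p0 : p 0 = 0.
Proof. by rewrite -(scale0r 0) -(rmorph0 iota) pZ// mul0r. Qed.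

Let subgraph (G : set (V * R)) := [/\
  forall x a y b, G (x, a) -> G (y, b) -> G (x + y, a + b),
  forall r x a, G (x, a) -> G (iota r *: x, r * a) &
  forall x a, G (x, a) -> a <= p x].

(** The one-dimensional extension.  An admissible value c at x1 must satisfy
    a - p (y - x1) <= c <= p (z + x1) - b for all pairs (y, a) and (z, b) of the
    graph; by sublinearity every left-hand side is at most every right-hand
    side. *)
Let extend G x1 : subgraph G -> (exists q, G q) ->
  exists c, subgraph [set q | exists y a t, G (y, a) /\
    q = (y + iota t *: x1, a + t * c)].
Proof.
move=> [GD GZ Gp] [[z0 a0] Gz0].
have G0 : G (0, 0) by have := GZ 0 _ _ Gz0; rewrite rmorph0 scale0r mul0r.
pose S := [set s | exists y a, G (y, a) /\ s = a - p (y - x1)].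
have Sub y a : G (y, a) -> ubound S (p (y + x1) - a).
  move=> Gy _ [z [b [Gz ->]]]; have h1 := Gp _ _ (GD _ _ _ _ Gz Gy).
  have := pD (z - x1) (y + x1); rewrite addrACA addNr addr0 => h2.
  lra.
have S0 : S !=set0 by exists (0 - p (0 - x1)), 0, 0.
have Shi : has_sup S by split=> //; exists (p (0 + x1) - 0); exact: Sub.
pose c := sup S; exists c.
have c1 y a : G (y, a) -> a + c <= p (y + x1).
  by move=> Gy; rewrite -lerBrDl; apply: ge_sup => // s Ss; exact: Sub Gy _ Ss.
have c2 y a : G (y, a) -> a - c <= p (y - x1).
  move=> Gy; rewrite lerBlDl -lerBlDr; apply: ub_le_sup; first exact: Shi.2.
  by exists y, a.
split.
- move=> _ _ _ _ [y [a [t [Gy [-> ->]]]]] [z [b [s [Gz [-> ->]]]]].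
  exists (y + z), (a + b), (t + s); split; first exact: GD.
  by rewrite rmorphD scalerDl mulrDl addrACA [X in (_, X)]addrACA.
- move=> r _ _ [y [a [t [Gy [-> ->]]]]].
  exists (iota r *: y), (r * a), (r * t); split; first exact: GZ.
  by rewrite rmorphM scalerDr scalerA mulrDr mulrA.
- move=> _ _ [y [a [t [Gy [-> ->]]]]].
  have scale s x : s != 0 -> iota s^-1 *: (iota s *: x) = x.
    by move=> s0; rewrite scalerA -rmorphM mulVf// rmorph1 scale1r.
  have [t0|t0|->] := ltrgt0P t.
  + have ti : 0 <= t^-1 by rewrite invr_ge0 ltW.
    rewrite -(@ler_pM2l _ t^-1) ?invr_gt0// -pZ//.
    rewrite mulrDr mulKf ?gt_eqF// scalerDr scale ?gt_eqF//.
    by apply: c1; apply: GZ.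
  + have t0' : 0 < - t by rewrite oppr_gt0.
    have ti : 0 <= (- t)^-1 by rewrite invr_ge0 ltW.
    rewrite -(@ler_pM2l _ (- t)^-1) ?invr_gt0// -pZ//.
    have -> : (- t)^-1 * (a + t * c) = (- t)^-1 * a - c.
      by rewrite mulrDr invrN !mulNr mulKf ?lt_eqF.
    have -> : iota (- t)^-1 *: (y + iota t *: x1) = iota (- t)^-1 *: y - x1.
      by rewrite scalerDr invrN rmorphN !scaleNr scale ?lt_eqF.
    by apply: c2; apply: GZ.
  + by rewrite rmorph0 scale0r mul0r !addr0; exact: Gp.
Qed.

(** Real functionals are handled through iota, so that the same proof serves real
    spaces and complex spaces seen as real ones.  The functional is a maximal
    linear graph below p among those containing (x0, p x0). *)
Lemma hahn_banach_sublinear (x0 : V) :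
  exists u : V -> R, [/\ forall x y, u (x + y) = u x + u y,
    forall r x, u (iota r *: x) = r * u x, forall x, u x <= p x & u x0 = p x0].
Proof.
pose G0 : set (V * R) := [set q | exists r, q = (iota r *: x0, r * p x0)].
have px r : r * p x0 <= p (iota r *: x0).
  have [r0|r0] := leP 0 r; first by rewrite pZ.
  have := pD (iota r *: x0) (iota (- r) *: x0).
  rewrite -scalerDl -rmorphD subrr rmorph0 scale0r p0 [p (iota (- r) *: _)]pZ.
    by rewrite mulNr subr_ge0.
  by rewrite oppr_ge0 ltW.
have QG0 : subgraph G0.
  split.
  - move=> _ _ _ _ [r [-> ->]] [s [-> ->]]; exists (r + s).
    by rewrite rmorphD scalerDl mulrDl.
  - move=> r _ _ [s [-> ->]]; exists (r * s); by rewrite rmorphM scalerA mulrA.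
  - by move=> _ _ [r [-> ->]].
have G0x : G0 (x0, p x0) by exists 1; rewrite rmorph1 scale1r mul1r.
pose P G := (exists q, G q) -> subgraph G /\ G (x0, p x0).
have [F FP Ftot|G [PG Gmax]] := @Zorn_bigcup _ P.
  move=> [q0 [X0 FX0 X0q]].
  have F2 w q : (\bigcup_(X in F) X) w -> (\bigcup_(X in F) X) q ->
      exists X, [/\ F X, subgraph X, X w & X q].
    move=> [X FX Xw] [Y FY Yq]; have [XY|YX] := Ftot _ _ FX FY.
      exists Y; split=> //; last exact: XY.
      by have [|] := FP _ FY; first by exists q.
    exists X; split=> //; last exact: YX.
    by have [|] := FP _ FX; first by exists w.
  split; last by exists X0 => //; have [|] := FP _ FX0; first by exists q0.
  split.
  - move=> x a y b /F2/[apply] -[X [FX [h _ _] Xx Xy]]; exists X => //; exact: h.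
  - move=> r x a h; have [X [FX [_ h' _] Xx _]] := F2 _ _ h h; exists X => //; exact: h'.
  - move=> x a h; have [X [FX [_ _ h'] Xx _]] := F2 _ _ h h; exact: h'.
have Gne : exists q, G q.
  apply: contrapT => h; apply: (Gmax G0).
    split; first by move=> q Gq; case: h; exists q.
    by move=> /(_ _ G0x) Gx; apply: h; exists (x0, p x0).
  by [].
have [QG Gx0] := PG Gne; have [GD GZ Gp] := QG.
have G00 : G (0, 0) by have := GZ 0 _ _ Gx0; rewrite rmorph0 scale0r mul0r.
have Gall x : exists a, G (x, a).
  apply: contrapT => h; have [c Qc] := @extend G x QG Gne.
  apply: (Gmax _ _ (fun _ => conj Qc _)).
    split.
      by move=> [y a] Gy; exists y, a, 0; rewrite rmorph0 scale0r mul0r !addr0.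
    move=> /(_ (x, c)) Gc; apply: h; exists c; apply: Gc.
    by exists 0, 0, 1; rewrite rmorph1 scale1r mul1r !add0r.
  by exists x0, (p x0), 0; rewrite rmorph0 scale0r mul0r !addr0.
have Gfun x a b : G (x, a) -> G (x, b) -> a = b.
  have le c d : G (x, c) -> G (x, d) -> c <= d.
    move=> Gc Gd; have := GD _ _ _ _ Gc (GZ (-1) _ _ Gd).
    rewrite rmorphN rmorph1 scaleN1r subrr mulN1r => /Gp.
    by rewrite p0 subr_le0.
  by move=> Ga Gb; apply/eqP; rewrite eq_le !le.
have [u uG] := choice Gall; exists u; split.
- by move=> x y; apply: Gfun (uG _) _; exact: GD.
- by move=> r x; apply: Gfun (uG _) _; exact: GZ.
- by move=> x; exact: Gp.
- by apply: Gfun (uG _) _.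
Qed.
End HahnBanachReal.

Section HahnBanach.
Variables (R : realType) (k : scalar_kind).

(** In the complex case a real functional u dominated by the norm is the real part
    of f x = u x - i u (i x); rotating x so that f x becomes real gives
    |f x| <= |x|. *)
Theorem hahn_banach (V : normedModType (scalars R k)) (x0 : V) :
  exists f : {linear V -> (scalars R k)^o},
    (forall x, `|f x| <= `|x|) /\ `|f x0| = `|x0|.
Proof.
case: k V x0 => /= V x0.
  have [||u [uD uZ up ux0]] := @hahn_banach_sublinear R R idfun V (fun x => `|x|) _ _ x0.
  - exact: ler_normD.
  - by move=> r x r0; rewrite /= normrZ ger0_norm.
  have [f fu] : exists f : {linear V -> R^o}, forall x, f x = u x.
    by apply: linear_exists => a x y; rewrite uD uZ.
  exists f; split; last by rewrite fu ux0 normr_id.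
  have uN x : u (- x) = - u x.
    by have := uZ (-1) x; rewrite /= scaleN1r mulN1r.
  move=> x; rewrite fu ler_norml up andbT lerNl -uN.
  by rewrite (le_trans (up _))// normrN.
pose p (x : V) : R := complex.Re `|x|.
have pE x : (p x)%:C%C = `|x| by apply: RRe_real; rewrite normr_real.
have [||u [uD uZ up ux0]] := @hahn_banach_sublinear R R[i] (real_complex R) V p _ _ x0.
- by move=> x y; rewrite -lecR rmorphD/= !pE ler_normD.
- move=> r x r0; apply: complexI; rewrite rmorphM/= !pE normrZ ger0_norm//.
  by rewrite ler0c.
have {}uZ (r : R) (x : V) : u ((r%:C)%C *: x) = r * u x := uZ r x.
have {}uD (x y : V) : u (x + y) = u x + u y := uD x y.
pose g (x : V) : R[i] := (u x +i* - u ('i%C *: x))%C.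
have uN (x : V) : u (- x) = - u x by have := uZ (-1) x; rewrite rmorphN rmorph1 scaleN1r mulN1r.
have gD (x y : V) : g (x + y) = g x + g y.
  by rewrite /g scalerDr !uD opprD.
have gR (r : R) (x : V) : g ((r%:C)%C *: x) = (r%:C)%C * g x.
  rewrite /g uZ scalerA ['i%C * _]mulrC -scalerA uZ.
  by apply/eqP; rewrite eq_complex /= !mul0r subr0 addr0 mulrN !eqxx.
have gi (x : V) : g ('i%C *: x) = 'i%C * g x.
  rewrite /g scalerA -expr2 sqr_i scaleN1r uN opprK.
  by apply/eqP; rewrite eq_complex /= !mul0r !mul1r sub0r opprK add0r !eqxx.
have [f fg] : exists f : {linear V -> R[i]^o}, forall x, f x = g x.
  apply: linear_exists => a x y; rewrite gD; congr (_ + _).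
  rewrite {1}(complexE a) scalerDl gD gR -scalerA gi gR mulrA -mulrDl -complexE //.
have Refle (x : V) : (complex.Re (f x))%:C%C <= `|x|.
  by rewrite fg /= -pE lecR.
have fle (x : V) : `|f x| <= `|x|.
  have [s [s1 sfx]] := sign_exists (f x).
  have fsx : f (s *: x) = `|f x| by rewrite linearZ /= -sfx.
  have -> : `|x| = `|s *: x| by rewrite normrZ s1 mul1r.
  rewrite -fsx -(@RRe_real _ (f (s *: x))) ?Refle// fsx.
  by rewrite normr_real.
exists f; split=> //; apply/eqP; rewrite eq_le fle /=.
rewrite -[leLHS]pE -ux0.
have -> : u x0 = complex.Re (f x0) by rewrite fg.
apply: le_trans (normc_ge_Re _); rewrite lecR; exact: ler_norm.
Qed.

End HahnBanach.

(** * The spaces E(I, X) *)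

(** Extend the injection one point at a time: if the bijection p already agrees
    with g on F, exchanging the values p f and g f corrects p at f, and leaves
    it unchanged on F because g is injective. *)
Lemma bijection_extending (I : choiceType) (F : seq I) (g : I -> I) :
  uniq F -> {in F &, injective g} ->
  exists p : I -> I, bijective p /\ {in F, p =1 g}.
Proof.
elim: F => [|f F IH] /=; first by exists id; split=> //; exists id.
move=> /andP[fF uF] ginj.
have [|p [bp pg]] := IH uF.
  by move=> x y xF yF; apply: ginj; rewrite inE ?xF ?yF orbT.
(* The transposition that exchanges p f and g f. *)
pose sw x := if x == p f then g f else if x == g f then p f else x.
have swK : involutive sw.
  move=> x; rewrite /sw; have [->|xp] := eqVneq x (p f).
    by have [->|_] := eqVneq (g f) (p f); rewrite ?eqxx.
  have [->|xg] := eqVneq x (g f); first by rewrite eqxx.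
  by rewrite (negbTE xp) (negbTE xg).
exists (sw \o p); split; first by apply: bij_comp => //; exists sw.
move=> x; rewrite inE => /orP[/eqP->|xF] /=; first by rewrite /sw eqxx.
have xf : x != f by apply: contraNneq fF => <-.
rewrite /sw (bij_eq bp) (negbTE xf) pg// ifN//.
apply: contra xf => /eqP gxf; apply/eqP; apply: ginj => //; rewrite inE ?xF ?eqxx ?orbT//.
Qed.

Section Families.
Context {K : numFieldType} {I : choiceType} {E : completeNormedModType K}.
Variable e : symBasis I E.
Implicit Types (X Y : completeNormedModType K).
Local Notation fam X := (fam (basis_solid e) X).

(** The symmetry of the norm is given for bijections of the index set; for a
    finite sum an injection is enough, because it agrees with a bijection on the
    support. *)
Lemma basis_reindex (F : {fset I}) (g : I -> I) (a : I -> K) :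
  {in F &, injective g} ->
  `|\sum_(i <- F) a i *: e (g i)| = `|\sum_(i <- F) a i *: e i|.
Proof.
move=> ginj; have [p [bp pg]] := bijection_extending (fset_uniq F) ginj.
pose b i := if i \in F then a i else 0.
have bs : usum_to (fun i => b i *: e i) (\sum_(i <- F) b i *: e i).
  by apply: usum_to_finite => i /negbTE iF; rewrite /b iF scale0r.
have [y [ys yE]] := @basis_symmetric _ _ _ e p (fun=> 1) b _ bp (fun=> normr1 _) bs.
have ps : usum_to (fun i => (1 * b i) *: e (p i)) (\sum_(i <- F) (1 * b i) *: e (p i)).
  by apply: usum_to_finite => i /negbTE iF; rewrite /b iF mulr0 scale0r.
have bF i : i \in F -> b i = a i by rewrite /b => ->.
have -> : \sum_(i <- F) a i *: e i = \sum_(i <- F) b i *: e i.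
  by apply: eq_fbigr => i /bF ->.
rewrite -yE -(usum_toE ys) (usum_toE ps); congr `| _ |.
by apply: eq_fbigr => i iF _; rewrite bF// mul1r pg.
Qed.

(** The comparison principle behind every norm estimate below: relabelling the
    terms of a finite sum injectively, decreasing the coefficients and dropping
    terms all decrease the norm. *)
Lemma basis_dominated (F G : {fset I}) (b c : I -> K) (g : I -> I) :
  {in F &, injective g} -> (forall i, i \in F -> g i \in G) ->
  (forall i, i \in F -> 0 <= b i <= c (g i)) -> (forall j, j \in G -> 0 <= c j) ->
  `|\sum_(i <- F) b i *: e i| <= `|\sum_(j <- G) c j *: e j|.
Proof.
move=> ginj gG bc c0.
pose b' i := if i \in F then b i else 0.
pose c' i := if i \in F then c (g i) else 0.
have -> : \sum_(i <- F) b i *: e i = \sum_(i <- F) b' i *: e i.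
  by apply: eq_fbigr => i iF _; rewrite /b' iF.
apply: (@le_trans _ _ `|\sum_(i <- F) c' i *: e i|).
  by apply: basis_solid_le => i; rewrite /b' /c'; case: ifP => [/bc//|]; rewrite lexx.
rewrite -(basis_reindex c' ginj).
have -> : \sum_(i <- F) c' i *: e (g i) = \sum_(j <- [fset g i | i in F]%fset) c j *: e j.
  by rewrite big_imfset//=; apply: eq_fbigr => i iF _; rewrite /c' iF.
pose d j := if j \in [fset g i | i in F]%fset then c j else 0.
have sub : ([fset g i | i in F] `<=` G)%fset.
  by apply/fsubsetP => _ /imfsetP[i /= iF ->]; exact: gG.
have -> : \sum_(j <- [fset g i | i in F]%fset) c j *: e j = \sum_(j <- G) d j *: e j.
  rewrite -(big_fset_incl _ sub).
    by apply: eq_fbigr => j jF _; rewrite /d jF.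
  by move=> j jG /negbTE jF; rewrite /d jF scale0r.
pose c1 j := if j \in G then c j else 0.
have -> : \sum_(j <- G) c j *: e j = \sum_(j <- G) c1 j *: e j.
  by apply: eq_fbigr => j jG _; rewrite /c1 jG.
apply: basis_solid_le => j; rewrite /d /c1; case: ifPn => jF.
  by have jG := fsubsetP sub _ jF; rewrite jG lexx c0.
by case: ifPn => [/c0 ->|_]; rewrite lexx.
Qed.

Lemma fam_norm_le X (z : fam X) (c : K) :
  (forall F : {fset I}, `|\sum_(i <- F) `|z i| *: e i| <= c) -> `|z| <= c.
Proof.
by move=> zc; rewrite fam_normE; apply: usum_to_norm_le (@fam_usum _ _ _ _ _ z).
Qed.

(** The only tool used to build operators on E(I, X): a family whose nonzero
    terms are controlled by distinct terms of z belongs to the space, with the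
    expected norm. *)
Lemma fam_dominated X Y (z : fam X) (y : I -> Y) (c : K) (g : I -> I) :
  0 <= c -> (forall i, y i <> 0 -> `|y i| <= c * `|z (g i)|) ->
  (forall i j, y i <> 0 -> y j <> 0 -> g i = g j -> i = j) ->
  exists w : fam Y, (forall i, w i = y i) /\ `|w| <= c * `|z|.
Proof.
move=> c0 yz ginj.
pose S (F : {fset I}) := [fset i in F | y i != 0]%fset.
have SE (F : {fset I}) : \sum_(i <- F) `|y i| *: e i = \sum_(i <- S F) `|y i| *: e i.
  apply/esym/big_fset_incl; first by apply/fsubsetP => i; rewrite !inE => /andP[].
  by move=> i iF; rewrite !inE iF /= negbK => /eqP->; rewrite normr0 scale0r.
have fin (F G : {fset I}) : (forall i, i \in S F -> g i \in G) ->
    `|\sum_(i <- F) `|y i| *: e i| <= c * `|\sum_(j <- G) `|z j| *: e j|.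
  move=> FG; rewrite SE -[c]ger0_norm// -normrZ scaler_sumr.
  under [in leRHS]eq_bigr do rewrite scalerA.
  apply: (@basis_dominated _ _ _ (fun j => c * `|z j|) g) => //.
  - by move=> i j; rewrite !inE => /andP[_ /eqP yi] /andP[_ /eqP yj]; exact: ginj.
  - by move=> i; rewrite !inE => /andP[_ /eqP/yz]; rewrite normr_ge0.
  - by move=> j _; rewrite mulr_ge0.
have yP : fam_pred (basis_solid e) y.
  apply/asboolP/usum_to_cauchy => r r0.
  have c1 : 0 < c + 1 by rewrite ltr_wpDl.
  have [A HA] := usum_to_tail (@fam_usum _ _ _ _ _ z) (divr_gt0 r0 c1).
  have Afin : finite_set [set i | y i <> 0 /\ g i \in A].
    apply: card_le_finite (finite_fset A).
    apply: (@card_le_inj _ _ _ _ g) => [i []//|i j [yi _] [yj _]].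
    exact: ginj.
  exists (fset_set [set i | y i <> 0 /\ g i \in A]) => H AH.
  apply: (@le_lt_trans _ _ (c * (r / (c + 1)))); last first.
    by rewrite mulrCA gtr_pMr// ltr_pdivrMr// mul1r ltrDl.
  apply: le_trans (fin H [fset g i | i in S H]%fset _) _.
    by move=> i iS; apply/imfsetP; exists i.
  apply: ler_wpM2l => //; apply/ltW/HA/fdisjointP => j jA.
  apply/negP => /imfsetP[i /=]; rewrite !inE => /andP[iH /eqP yi] jg.
  move: AH => /fdisjointP/(_ i); rewrite in_fset_set// iH.
  by move=> /(_ _)/negP; apply => //; rewrite inE /=; split=> //; rewrite -jg.
exists (Fam yP); split => //; apply: fam_norm_le => F.
apply: le_trans (fin F [fset g i | i in S F]%fset _) _.
  by move=> i iS; apply/imfsetP; exists i.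
apply: ler_wpM2l => //; exact: fam_norm_ge.
Qed.

Section Coordinates.
Context {X : completeNormedModType K}.
Implicit Types z w : fam X.

Lemma fam_ext z w : (forall i, z i = w i) -> z = w.
Proof. by move=> h; apply/val_inj/funext. Qed.

Lemma famD z w i : (z + w) i = z i + w i. Proof. by []. Qed.
Lemma famZ a z i : (a *: z) i = a *: z i. Proof. by []. Qed.

Lemma single_subproof (i : I) (x : X) :
  fam_pred (basis_solid e) (fun j => if j == i then x else 0).
Proof.
apply/asboolP; exists (\sum_(j <- [fset i]%fset) `|if j == i then x else 0| *: e j).
by apply: usum_to_finite => j; rewrite inE => /negbTE ->; rewrite normr0 scale0r.
Qed.

Definition single i x : fam X := Fam (single_subproof i x).

Lemma singleE i x j : single i x j = if j == i then x else 0. Proof. by []. Qed.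

Lemma single_linear i : linear (single i).
Proof.
move=> a x y; apply: fam_ext => j; rewrite famD famZ !singleE.
by case: eqP => // _; rewrite scaler0 addr0.
Qed.

HB.instance Definition _ i :=
  GRing.isLinear.Build K X (fam X) *:%R (single i) (single_linear i).

Lemma norm_single i x : `|single i x| = `|x|.
Proof.
rewrite fam_normE /fam_sum (@usum_toE _ _ _ _ (`|x| *: e i)).
  by rewrite normrZ basis_norm1 mulr1 normr_id.
have := @usum_to_finite K I E (fun j => `|single i x j| *: e j) [fset i]%fset.
rewrite big_seq_fset1 singleE eqxx; apply=> j; rewrite inE singleE => /negbTE ->.
by rewrite normr0 scale0r.
Qed.

Definition coord i (z : fam X) : X := z i.

Lemma coord_linear i : linear (coord i).
Proof. by []. Qed.

HB.instance Definition _ i :=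
  GRing.isLinear.Build K (fam X) X *:%R (coord i) (coord_linear i).

Lemma norm_coord i z : `|coord i z| <= `|z|.
Proof. exact: fam_norm_ge1. Qed.

Lemma sum_singleE (F : {fset I}) (x : I -> X) j :
  (\sum_(i <- F) single i (x i)) j = if j \in F then x j else 0.
Proof.
have -> : (\sum_(i <- F) single i (x i)) j = \sum_(i <- F) (if j == i then x i else 0).
  by rewrite (big_morph (fun z : fam X => z j) (id1 := 0) (op1 := +%R)).
case: ifPn => jF.
  rewrite (big_fsetD1 j)//= eqxx big_seq big1 ?addr0// => i.
  by rewrite !inE eq_sym => /andP[/negbTE ->].
rewrite big_seq big1// => i iF; case: eqP => // ji.
by rewrite ji iF in jF.
Qed.

Lemma fam_expand z : usum_to (fun i => single i (z i)) z.
Proof.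
apply/usum_toP => r r0; have r20 : 0 < r / 2 by rewrite divr_gt0.
have [A HA] := usum_to_tail (@fam_usum _ _ _ _ _ z) r20; exists A => B AB.
apply: (@le_lt_trans _ _ (r / 2)); last by rewrite ltr_pdivrMr// ltr_pMr// ltr1n.
apply: fam_norm_le => F.
have -> : \sum_(i <- F) `|(z - \sum_(i <- B) single i (z i)) i| *: e i =
    \sum_(i <- (F `\` B)%fset) `|z i| *: e i.
  rewrite -(big_fset_incl _ (fsubsetDl F B)).
    apply: eq_fbigr => i; rewrite inE => /andP[/negbTE iB _] _.
    by rewrite fam_subE sum_singleE iB subr0.
  move=> i iF; rewrite inE iF andbT negbK => iB.
  by rewrite fam_subE sum_singleE iB subrr normr0 scale0r.
apply/ltW/HA/fdisjointP => i iA; rewrite inE negb_and negbK.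
by rewrite (fsubsetP AB _ iA).
Qed.

(** Finitely supported families are dense, in the precise sense that z is the
    unordered sum of its coordinates. *)
Lemma operator_vanish (Y : normedModType K) (S : {linear fam X -> Y}) (c : K) z :
  (forall w, `|S w| <= c * `|w|) -> (forall i, S (single i (z i)) = 0) -> S z = 0.
Proof.
move=> Sc Sz; apply/normr0_eq0/eqP; rewrite -normr_le0; apply/ler_addgt0Pr => r r0.
rewrite normr_id add0r.
have c1 : 0 < `|c| + 1 by rewrite ltr_wpDl.
have /usum_toP/(_ _ (divr_gt0 r0 c1))[A /(_ A (fsubset_refl _))/ltW HA] := @fam_expand z.
have -> : S z = S (z - \sum_(i <- A) single i (z i)).
  rewrite linearB linear_sum big1 ?subr0// => i _; exact: Sz.
apply: le_trans (Sc _) _; apply: (@le_trans _ _ (`|c| * (r / (`|c| + 1)))).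
  have [h|h] := eqVneq (z - \sum_(i <- A) single i (z i)) 0.
    by rewrite h normr0 mulr0 mulr_ge0// divr_ge0 ?ltW.
  have c0 : 0 <= c.
    rewrite -(@pmulr_lge0 _ `|z - \sum_(i <- A) single i (z i)|) ?normr_gt0//.
    by rewrite (le_trans _ (Sc _)).
  by rewrite -{1}(ger0_norm c0) ler_wpM2l.
by rewrite mulrCA ger_pMr// ler_pdivrMr// mul1r lerDl.
Qed.

Lemma fam_large_finite z (r : K) : 0 < r -> finite_set [set i | r <= `|z i|].
Proof.
move=> r0; have [F HF] := usum_to_tail (@fam_usum _ _ _ _ _ z) r0.
apply: (@sub_finite_set _ _ [set` F]); last exact: finite_fset.
move=> i zi /=; apply: contrapT => /negP iF.
have := HF [fset i]%fset; rewrite big_seq_fset1 normrZ basis_norm1 mulr1 normr_id.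
rewrite fdisjointX1 => /(_ iF) /(le_lt_trans zi); by rewrite ltxx.
Qed.

End Coordinates.

End Families.

Section Support.
Variables (R : realType) (k : scalar_kind).
Local Notation K := (scalars R k).

Lemma fam_support_countable (I : choiceType) (E X : completeNormedModType K)
  (e : symBasis I E) (z : fam (basis_solid e) X) : countable [set i | z i <> 0].
Proof.
have : [set i | z i <> 0] `<=` \bigcup_n [set i | n.+1%:R^-1 <= `|z i|].
  move=> i /eqP/=; rewrite -normr_eq0 => /scalars_inv_nat[n].
  by rewrite normr_id => h; exists n.
move=> /subset_card_le/card_le_trans; apply.
apply: bigcup_countable; first exact: countableP.
move=> n _; apply: finite_set_countable; apply: fam_large_finite.
by rewrite invr_gt0 ltr0Sn.
Qed.

End Support.

(** * Rows and columns of an operator on E(I, X) *)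

Section Rows.
Variables (R : realType) (k : scalar_kind) (I : choiceType).
Local Notation K := (scalars R k).
Variables (E : completeNormedModType K) (e : symBasis I E).
Local Notation fam X := (fam (basis_solid e) X).

(** Only the lower l_1-estimate is in question, since the triangle inequality
    gives the upper one for any normalised basis. *)
Lemma ell1_equivalent (c : K) : 0 < c ->
  (forall (F : {fset I}) (a : I -> K),
    \sum_(i <- F) `|a i| <= c * `|\sum_(i <- F) a i *: e i|) ->
  equivalent_bases e (ell1_basis R k I).
Proof.
move=> c0 ce a; split=> -[s as_]; apply: usum_to_cauchy => r r0.
  have [A HA] := usum_to_tail as_ (divr_gt0 r0 c0); exists A => H /HA.
  rewrite ltr_pdivlMr// mulrC; apply: le_lt_trans; apply: le_trans (ce H a).
  apply: le_trans (ler_norm_sum _ _ _) _; apply: ler_sum => i _.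
  by rewrite normrZ basis_norm1 mulr1.
have [A HA] := usum_to_tail as_ r0; exists A => H /HA.
apply: le_lt_trans; apply: le_trans (ler_norm_sum _ _ _) _.
have := fam_norm_ge (\sum_(i <- H) a i *: ell1_vec R k i) H.
rewrite one_vec_sum//; apply: le_trans; rewrite big_seq [leRHS]big_seq.
by apply: ler_sum => i iH; rewrite normrZ basis_norm1 mulr1 ell1_combE iH.
Qed.

Hypothesis e_not_ell1 : ~ equivalent_bases e (ell1_basis R k I).
Context {X : completeNormedModType K}.

(** If phi were at least r on unit vectors in infinitely many coordinate copies of
    X, any finite index set F could be moved into these coordinates.  For scalars
    (a_i) the corresponding vectors, rotated so that phi takes nonnegative
    values on them, would add up to z with
    r (sum of |a_i|) <= |phi z| <= c |z|, and |z| is at most the norm of the sum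
    of the a_i e_i.  So the basis would be equivalent to that of l_1. *)
Lemma functional_large_finite (phi : {linear fam X -> K^o}) (c r : K) :
  0 < c -> (forall z, `|phi z| <= c * `|z|) -> 0 < r ->
  finite_set [set i | exists x, `|x| <= 1 /\ r <= `|phi (single e i x)|].
Proof.
move=> c0 phic r0; set B := [set i | _]; apply: contrapT => Binf.
apply: e_not_ell1; apply: (@ell1_equivalent (c / r)); first exact: divr_gt0.
move=> F a; have [i0 Bi0] := infinite_setN0 Binf.
have FB : [set` F] #<= B by apply: countable_card_le => //; exact: countable_fset.
have [t [tB tinj]] := card_le_injfun i0 FB.
have [x xP] : exists x : I -> X, forall i, B i ->
    `|x i| <= 1 /\ r <= `|phi (single e i (x i))|.
  have h i : exists x : X, B i -> `|x| <= 1 /\ r <= `|phi (single e i x)|.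
    by have [[x hx]|nB] := pselect (B i); [exists x|exists 0].
  by have [x hx] := choice h; exists x.
have [g gt] : exists g : I -> I, forall i, i \in F -> g (t i) = i.
  have h j : exists i : I, forall i', i' \in F -> t i' = j -> i' = i.
    have [[i [iF ij]]|h] := pselect (exists i, i \in F /\ t i = j).
      by exists i => i' i'F; rewrite -ij => /tinj; apply.
    by exists j => i iF ij; case: h; exists i.
  by have [g hg] := choice h; exists g => i iF; apply/esym/hg.
have [s sP] := choice (fun i => sign_exists (phi (single e (t i) (a i *: x (t i))))).
pose y j := s (g j) *: (a (g j) *: x j).
pose G := [fset t i | i in F]%fset.
have tinjF : {in F &, injective t} by move=> i j iF jF; exact: tinj.
pose z : fam X := \sum_(j <- G) single e j (y j).
have zn : `|z| <= `|\sum_(i <- F) a i *: e i|.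
  have [u uP] := choice (fun i => sign_exists (a i)).
  (* Changing signs replaces a_i by |a_i| without changing the norm. *)
  rewrite -(basis_sign e F a (fun i => (uP i).1)).
  under eq_bigr do rewrite (uP _).2.
  apply: fam_norm_le => H.
  have -> : \sum_(j <- H) `|z j| *: e j = \sum_(j <- (H `&` G)%fset) `|y j| *: e j.
    rewrite -(big_fset_incl _ (fsubsetIl H G)).
      by apply: eq_fbigr => j; rewrite inE => /andP[_ jG] _; rewrite sum_singleE jG.
    move=> j jH; rewrite inE jH /= => /negbTE jG.
    by rewrite sum_singleE jG normr0 scale0r.
  have GF j : j \in (H `&` G)%fset -> exists2 i, i \in F & t i = j.
    by rewrite inE => /andP[_ /imfsetP[i /= iF ->]]; exists i.
  apply: (@basis_dominated _ _ _ e _ _ _ (fun i => `|a i|) g) => //.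
  - by move=> i j /GF[i' i'F <-] /GF[j' j'F <-]; rewrite !gt// => ->.
  - by move=> i /GF[i' i'F <-]; rewrite gt.
  - move=> i /GF[i' i'F <-]; rewrite normr_ge0 /y gt// !normrZ (sP i').1 mul1r.
    by rewrite ler_piMr// (xP _ _).1//; apply: tB.
have phiz : r * \sum_(i <- F) `|a i| <= `|phi z|.
  rewrite linear_sum big_imfset//=.
  have -> : \sum_(i <- F) phi (single e (t i) (y (t i))) =
      \sum_(i <- F) `|phi (single e (t i) (a i *: x (t i)))|.
    apply: eq_fbigr => i iF _; rewrite /y gt// linearZ linearZ /=.
    by rewrite [LHS](sP i).2.
  rewrite ger0_norm ?sumr_ge0// mulr_sumr big_seq [leRHS]big_seq.
  apply: ler_sum => i iF; rewrite linearZ linearZ /= [X in _ <= X]normrM mulrC.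
  by rewrite ler_wpM2l// (xP _ (tB _ iF)).2.
rewrite mulrAC ler_pdivlMr// mulrC (le_trans phiz)// (le_trans (phic z))//.
by rewrite ler_wpM2l// ltW.
Qed.

(** An entry S (single i x) <> 0 is detected by some f in the total set; apply
    functional_large_finite to the functionals f o S and the thresholds
    1/(n+1). *)
Lemma row_support_countable (S : {linear fam X -> X}) (c : K) (M : set (dual X)) :
  countable M -> total_set M -> (forall z, `|S z| <= c * `|z|) ->
  countable [set i | exists x, S (single e i x) <> 0].
Proof.
move=> Mc Mtot Sc.
pose B (f : dual X) n := [set i | exists x, `|x| <= 1 /\
  n.+1%:R^-1 <= `|sval f (S (single e i x))|].
have : [set i | exists x, S (single e i x) <> 0] `<=` \bigcup_(f in M) \bigcup_n B f n.
  move=> i [x Sx].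
  have [f [Mf fx]] : exists f, M f /\ sval f (S (single e i x)) <> 0.
    apply: contrapT => h; apply: Sx; apply: Mtot => f Mf; apply: contrapT => fx.
    by apply: h; exists f.
  have x0 : x != 0 by apply/eqP => x0; apply: fx; rewrite x0 !linear0.
  have : `|sval f (S (single e i (`|x|^-1 *: x)))| != 0.
    rewrite normr_eq0 !linearZ /= scaler_eq0 invr_eq0 normr_eq0 negb_or x0.
    exact/eqP.
  rewrite normr_eq0 => /scalars_inv_nat[n hn]; exists f => //; exists n => //.
  exists (`|x|^-1 *: x); split=> //.
  by rewrite normrZ normfV normr_id mulVf// normr_eq0.
move=> /subset_card_le/card_le_trans; apply.
apply: bigcup_countable => // f Mf; apply: bigcup_countable; first exact: countableP.
move=> n _; apply: finite_set_countable.
have [d d0 fd] := continuous_bound (svalP f).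
apply: (@functional_large_finite (sval f \o S) (d * (`|c| + 1))).
- by rewrite mulr_gt0// ltr_wpDl.
- move=> z /=; apply: le_trans (fd _) _; rewrite -mulrA ler_wpM2l ?(ltW d0)//.
  have [z0|z0] := eqVneq z 0; first by rewrite z0 linear0 !normr0 mulr0.
  have c0 : 0 <= c.
    by rewrite -(@pmulr_lge0 _ `|z|) ?normr_gt0// (le_trans _ (Sc z)).
  by apply: le_trans (Sc z) _; rewrite ler_wpM2r// ger0_norm// lerDl.
- by rewrite invr_gt0 ltr0Sn.
Qed.

End Rows.

Section Separable.
Variables (R : realType) (k : scalar_kind) (X : completeNormedModType (scalars R k)).
Local Notation K := (scalars R k).

Lemma dense_approx (D : set X) (x : X) (r : K) : dense D -> 0 < r ->
  exists2 d, D d & `|x - d| < r.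
Proof.
move=> Dd r0; have [|d [/= xd Dd']] := Dd (ball x r) _ (ball_open x r).
  by exists x; exact: ballxx.
by exists d => //; rewrite -ball_normE in xd.
Qed.

(** Take norming functionals f_d for the points d of a countable dense set.  If
    they all vanish at x, then |d| = |f_d (d - x)| <= |d - x| for all d, which is
    absurd for d close to x when x <> 0. *)
Lemma separable_total : separable X ->
  exists2 M : set (dual X), countable M & total_set M.
Proof.
move=> [D Dc Dd].
have h d : exists f : dual X, (forall x, `|sval f x| <= `|x|) /\ `|sval f d| = `|d|.
  have [f [f1 fd]] := hahn_banach d.
  have fc : continuous f by apply: (@bound_continuous _ _ _ _ 1) => x; rewrite mul1r.
  by exists (exist _ f fc).
have [f fP] := choice h; exists (f @` D).
  exact: card_le_trans (card_image_le _ _) Dc.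
move=> x fx; apply: contrapT => /eqP x0.
have x1 : 0 < `|x| / 2 by rewrite divr_gt0 ?normr_gt0.
have [d Dd' xd] := dense_approx x Dd x1.
have /fx fdx : (f @` D) (f d) by exists d.
have dx : `|d| < `|x| / 2.
  rewrite -(fP d).2 -[sval (f d) d]subr0 -fdx -linearB.
  by apply: le_lt_trans ((fP d).1 _) _; rewrite distrC.
have : `|x| < `|x|.
  rewrite -{1}(subrK d x) (le_lt_trans (ler_normD _ _))// [ltRHS]splitr.
  exact: ltrD.
by rewrite ltxx.
Qed.

Lemma separable_column_support_countable (I : choiceType) (E : completeNormedModType K)
  (e : symBasis I E) (S : {linear X -> fam (basis_solid e) X}) :
  separable X -> continuous S -> countable [set i | exists x, S x i <> 0].
Proof.
move=> [D Dc Dd] /continuous_bound[c c0 Sc].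
have : [set i | exists x, S x i <> 0] `<=` \bigcup_(d in D) [set i | S d i <> 0].
  move=> i [x /eqP Sx].
  have r0 : 0 < `|S x i| / c by rewrite divr_gt0 ?normr_gt0.
  have [d Dd' xd] := dense_approx x Dd r0.
  exists d => // Sd.
  have : `|S x i| < `|S x i|.
    rewrite -{1}[S x i]subr0 -Sd -fam_subE -linearB.
    apply: le_lt_trans (norm_coord _ _) _; apply: le_lt_trans (Sc _) _.
    by rewrite mulrC -ltr_pdivlMr.
  by rewrite ltxx.
move=> /subset_card_le/card_le_trans; apply.
by apply: bigcup_countable => // d _; exact: fam_support_countable.
Qed.

End Separable.

(** * Weakly compact sets and l_1(I, X) *)

Section WeakCompactness.
Variables (K : numFieldType) (X : completeNormedModType K).

Lemma weak_eval_continuous (f : dual X) :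
  continuous (fun x : weak X => (sval f x : K^o)).
Proof.
move=> x; apply: (@continuous_comp (weak X) {ptws dual X -> K^o} K^o
   (fun x => (fun f => sval f x)) (fun g => g f)).
  exact: (@initial_continuous _ _ (fun x : X => (fun f => sval f x) : {ptws dual X -> K^o})).
exact: (@proj_continuous {classic (dual X)} (fun=> K^o : topologicalType) f).
Qed.

(** Compactness supplies a cluster point, without passing to subsequences. *)
Lemma weak_cluster_point (W : set X) (w : nat -> X) :
  weakly_compact W -> (forall n, W (w n)) ->
  exists p, forall (f : dual X) (r : K) (m : nat), 0 < r ->
    exists2 n, (m <= n)%N & `|sval f p - sval f (w n)| < r.
Proof.
move=> Wc Ww; have [|p [Wp pcl]] := Wc (w @ \oo) _.
  by exists 0%N => // n _; exact: Ww.
exists p => f r m r0.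
have [|| x [[n /= mn <-] xr]] := pcl (w @` [set n | (m <= n)%N])
   [set x | `|sval f p - sval f x| < r].
- by exists m => // n /= mn; exists n.
- have /cvgrPdist_lt := @weak_eval_continuous f p; exact.
by exists n.
Qed.

End WeakCompactness.

Section Columns.
Variables (R : realType) (k : scalar_kind) (I : choiceType).
Local Notation K := (scalars R k).
Variable X : completeNormedModType K.
Local Notation e := (ell1_basis R k I).
Local Notation fam := (fam (basis_solid e) X).

Lemma ell1_sum_norm (F : {fset I}) (a : I -> K) : (forall i, 0 <= a i) ->
  `|\sum_(i <- F) a i *: e i| = \sum_(i <- F) a i.
Proof.
move=> a0; apply/eqP; rewrite eq_le; apply/andP; split.
  apply: le_trans (ler_norm_sum _ _ _) _; apply: ler_sum => i _.
  by rewrite normrZ basis_norm1 mulr1 ger0_norm.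
have := fam_norm_ge (\sum_(i <- F) a i *: ell1_vec R k i) F.
rewrite one_vec_sum//; apply: le_trans; rewrite big_seq [leRHS]big_seq.
by apply: ler_sum => i iF; rewrite ell1_combE iF; exact: real_ler_norm (ger0_real (a0 i)).
Qed.

Lemma ell1_fam_tail (z : fam) (r : K) : 0 < r -> exists A : {fset I},
  forall H : {fset I}, [disjoint A & H]%fset -> \sum_(i <- H) `|z i| < r.
Proof.
move=> r0; have [A HA] := usum_to_tail (@fam_usum _ _ _ _ _ z) r0.
by exists A => H /HA; rewrite ell1_sum_norm.
Qed.

Lemma ell1_fam_sum_le (z : fam) (F : {fset I}) : \sum_(i <- F) `|z i| <= `|z|.
Proof. by rewrite -ell1_sum_norm//; exact: fam_norm_ge. Qed.

(** The dual of l_1(I, X) contains every bounded family of functionals. *)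
Lemma summing_functional (h : I -> {linear X -> K^o}) :
  (forall i x, `|h i x| <= `|x|) ->
  exists phi : {linear fam -> K^o}, forall z : fam,
    usum_to (fun i => h i (z i) : scalar_line R k) (phi z : scalar_line R k) /\
    `|phi z| <= `|z|.
Proof.
move=> h1.
have hs (z : fam) : exists s : scalar_line R k,
    usum_to (fun i => h i (z i) : scalar_line R k) s.
  apply: usum_to_cauchy => r /(ell1_fam_tail z)[A HA]; exists A => H /HA.
  apply: le_lt_trans; apply: le_trans (ler_norm_sum _ _ _) _; apply: ler_sum => i _.
  exact: h1.
have [s sP] := choice hs.
have [phi phiE] : exists phi : {linear fam -> K^o}, forall z, phi z = s z.
  apply: linear_exists => a z w.
  have := usum_toD (usum_toZ (k := a) (sP z)) (sP w).
  rewrite (_ : (fun i => _) = (fun i => h i ((a *: z + w) i) : scalar_line R k)).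
    by move=> /usum_toE <-; rewrite (usum_toE (sP (a *: z + w : fam))).
  by apply/funext => i; rewrite famD famZ linearP.
exists phi => z; rewrite phiE; split; first exact: sP.
apply: usum_to_norm_le (sP z) => F.
apply: le_trans (ler_norm_sum _ _ _) _; apply: le_trans (ell1_fam_sum_le z F).
apply: ler_sum => i _; exact: h1.
Qed.

(** Suppose there were uncountably many i with a witness w i in W such that S (w i)
    is at least 4q at i.  Each S (w i) has mass less than q off a finite set F i.
    Uncountably many of the F i have at most n elements for some n, so there is
    an infinite free set b 0, b 1, ... for F.  Let phi m add up norming
    functionals for the coordinates b j, j >= m.  By freeness |phi m| is at least
    2q at S (w (b j)) for all j >= m, hence at least q at S p for a weak cluster
    point p of the w (b j).  This holds for every m, although phi m (S p) is
    bounded by a tail of a convergent sum. *)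
Lemma weakly_compact_large_countable (S : {linear X -> fam}) (W : set X) (q : K) :
  continuous S -> weakly_compact W -> 0 < q ->
  countable [set i | exists2 w, W w & q *+ 4 <= `|S w i|].
Proof.
move=> /continuous_bound[c c0 Sc] Wc q0; set B := [set i | _].
apply: contrapT => Bunc.
have [w wP] : exists w : I -> X, forall i, B i -> W (w i) /\ q *+ 4 <= `|S (w i) i|.
  have h i : exists w, B i -> W w /\ q *+ 4 <= `|S w i|.
    by have [[w Ww Sw]|nB] := pselect (B i); [exists w|exists 0].
  by have [w hw] := choice h; exists w.
have [F FP] := choice (fun i => ell1_fam_tail (S (w i)) q0).
have [n Bn] : exists n, infinite_set [set i | B i /\ (#|` F i| <= n)%N].
  apply: contrapT => /forallNP h; apply: Bunc.
  have : B `<=` \bigcup_n [set i | B i /\ (#|` F i| <= n)%N].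
    by move=> i Bi; exists #|` F i|.
  move=> /subset_card_le/card_le_trans; apply; apply: bigcup_countable.
    exact: countableP.
  by move=> n _; apply: finite_set_countable; apply: contrapT; exact: h.
have [D [DB Dinf Dfree]] := infinite_free_set Bn (fun i => @proj2 _ _).
have [i0 _] := infinite_setN0 Dinf.
have /(card_le_injfun i0)[b [bD binj]] : [set: nat] #<= D by exact/infiniteP.
have {}binj : injective b by move=> i j; exact: binj.
have {}bD m : D (b m) by exact: bD.
have bB m : B (b m) by have [] := DB _ (bD m).
pose y m := S (w (b m)).
have yb m : q *+ 4 <= `|y m (b m)| by have [] := wP _ (bB m).
have [f fP] := choice (fun m => hahn_banach (y m (b m))).
have [p pP] := weak_cluster_point Wc (fun m => (wP _ (bB m)).1).
pose zero : {linear X -> K^o} := \0.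
(* The functional f j at the coordinate b j for j >= m, and 0 elsewhere. *)
pose h m i : {linear X -> K^o} :=
  if pselect (exists j, (m <= j)%N /\ b j = i) is left mj then f (sval (cid mj)) else zero.
have h1 m i x : `|h m i x| <= `|x|.
  rewrite /h; case: pselect => [mj|_]; first exact: (fP _).1.
  by rewrite /zero /= normr0.
have hb m j : (m <= j)%N -> h m (b j) = f j.
  move=> mj; rewrite /h; case: pselect => [e|[]]; last by exists j.
  by case: cid => j' /= [_ /binj ->].
have h0 m i : ~ (exists j, (m <= j)%N /\ b j = i) -> forall x, h m i x = 0.
  by move=> nj x; rewrite /h; case: pselect.
have [phi phiP] := choice (fun m => summing_functional (h1 m)).
have phi_big m j : (m <= j)%N -> q *+ 2 <= `|phi m (y j)|.
  move=> mj; have [/usum_toP/(_ _ q0)[A HA] _] := phiP m (y j).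
  have := HA (b j |` A)%fset (fsubsetU1 _ _).
  rewrite (big_fsetD1 (b j)) ?fset1U1//= hb//.
  set G := (_ `\ b j)%fset.
  have bG i : i \in G -> i <> b j by rewrite !inE => /andP[/eqP].
  move: G bG => G bG; set s := \sum_(i <- G) _.
  (* The terms other than that of b j sit at indices b j' outside F (b j). *)
  have sq : `|s| <= q.
    pose G' := [fset i in G | `[< exists j', (m <= j')%N /\ b j' = i >]]%fset.
    have -> : s = \sum_(i <- G') (h m i (y j i) : scalar_line R k).
      rewrite /s; apply/esym/big_fset_incl.
        by apply/fsubsetP => i; rewrite !inE => /andP[].
      by move=> i iG; rewrite !inE iG /= => /asboolPn nj; exact: (h0 _ _ nj).
    apply: le_trans (ler_norm_sum _ _ _) _.
    apply: (@le_trans _ _ (\sum_(i <- G') `|y j i|)).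
      by apply: ler_sum => i _; exact: h1.
    apply/ltW/FP/fdisjointP => i iF; apply/negP; rewrite !inE.
    move=> /andP[/bG ij /asboolP[j' [_ ji]]].
    apply: (Dfree (b j) i) => //; last by move=> /esym.
    by rewrite -ji; exact: bD.
  move=> phis; have fj : `|f j (y j (b j))| = `|y j (b j)| by exact: (fP j).2.
  have : q *+ 4 <= `|phi m (y j)| + q + q.
    apply: le_trans (yb j) _; rewrite -fj.
    set P := phi m (y j) in phis *; set Fj := f j _ in phis *.
    have -> : Fj = P - (P - (Fj + s)) - s by ring.
    apply: le_trans (ler_normB _ _) _; apply: lerD => //.
    by apply: le_trans (ler_normB _ _) _; apply: lerD => //; exact: ltW.
  by rewrite -addrA -mulr2n -lerBlDr -mulrnBr.
have phiS m : exists g : dual X, forall x, sval g x = phi m (S x).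
  pose g : {linear X -> K^o} := phi m \o S.
  have gc : continuous g.
    apply: (@bound_continuous _ _ _ _ c) => x.
    by apply: le_trans (phiP _ _).2 _; exact: Sc.
  by exists (exist _ g gc).
have phi_p m : q <= `|phi m (S p)|.
  have [g gE] := phiS m; have [j mj] := pP g q m q0; rewrite !gE => pj.
  have := phi_big m j mj; rewrite /y => h2.
  have : q *+ 2 <= `|phi m (S p)| + q.
    apply: le_trans h2 _; rewrite -[X in `|X| <= _](subrKC (phi m (S p))).
    apply: le_trans (ler_normD _ _) _; rewrite lerD2l distrC; exact: ltW.
  by rewrite mulr2n lerD2r.
have q2 : 0 < q / 2 by rewrite divr_gt0.
have [A HA] := ell1_fam_tail (S p) q2.
have [m mA] : exists m, forall j, (m <= j)%N -> b j \notin A.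
  have Jfin : finite_set [set j | b j \in A].
    apply: card_le_finite (finite_fset A).
    by apply: (@card_le_inj _ _ _ _ b) => // i j _ _; exact: binj.
  exists (\max_(j <- fset_set [set j | b j \in A]) j).+1 => j mj; apply/negP => jA.
  have : j \in fset_set [set j | b j \in A] by rewrite in_fset_set// mem_set.
  by move=> /(@leq_bigmax_seq _ _ xpredT id)/(_ isT); rewrite leqNgt mj.
have := phi_p m; have : `|phi m (S p)| <= q / 2.
  have [phis _] := phiP m (S p); apply: usum_to_norm_le phis => G.
  pose G' := [fset i in G | `[< exists j', (m <= j')%N /\ b j' = i >]]%fset.
  have -> : \sum_(i <- G) (h m i (S p i) : scalar_line R k) =
     \sum_(i <- G') (h m i (S p i) : scalar_line R k).
    apply/esym/big_fset_incl.
      by apply/fsubsetP => i; rewrite !inE => /andP[].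
    by move=> i iG; rewrite !inE iG /= => /asboolPn nj; exact: (h0 _ _ nj).
  apply: le_trans (ler_norm_sum _ _ _) _.
  apply: (@le_trans _ _ (\sum_(i <- G') `|S p i|)).
    by apply: ler_sum => i _; exact: h1.
  apply/ltW/HA/fdisjointP => i iA; apply/negP; rewrite !inE.
  move=> /andP[_ /asboolP[j' [mj' ji]]].
  by have := mA _ mj'; rewrite ji iA.
move=> le1 /le_trans/(_ le1); rewrite ler_pdivlMr// ger_pMr// -[1]/(1%:R) ler_nat.
by [].
Qed.

(** A coordinate of S that vanishes on W vanishes on the closed span of W, so it is
    enough to look at the points of W. *)
Lemma WCG_column_support_countable (S : {linear X -> fam}) : WCG X -> continuous S ->
  countable [set i | exists x, S x i <> 0].
Proof.
move=> [W Wc Wspan] Scont; have [c c0 Sc] := continuous_bound Scont.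
have : [set i | exists x, S x i <> 0] `<=` \bigcup_n
    [set i | exists2 w, W w & (n.+1%:R^-1 / 4 : K) *+ 4 <= `|S w i|].
  move=> i [x Sx].
  have [w [Ww Sw]] : exists w, W w /\ S w i <> 0.
    apply: contrapT => h; apply: Sx.
    have SW w : W w -> S w i = 0 by move=> Ww; apply: contrapT => Sw; apply: h; exists w.
    apply/normr0_eq0/eqP; rewrite -normr_le0 normr_id; apply/ler_addgt0Pr => r r0.
    rewrite add0r.
    have : closure (linear_span W) x by rewrite Wspan.
    move=> /(_ (ball x (r / c)))[|y [[n [a [u [Wu ->]]]]]].
      by apply: nbhsx_ballx; rewrite divr_gt0.
    rewrite -ball_normE /= => /ltW xy.
    have -> : S x i = S (x - \sum_i0 a i0 *: u i0) i.
      rewrite linearB fam_subE linear_sum.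
      rewrite (big_morph (fun z : fam => z i) (id1 := 0) (op1 := +%R))//.
      by rewrite big1 ?subr0// => j _; rewrite linearZ famZ SW// scaler0.
    apply: le_trans (norm_coord _ _) _; apply: le_trans (Sc _) _.
    by rewrite mulrC -ler_pdivlMr.
  have /eqP := Sw; rewrite -normr_eq0 => /scalars_inv_nat[n].
  rewrite normr_id => h; exists n => //; exists w => //.
  by rewrite -[_ *+ 4]mulr_natr divfK ?pnatr_eq0.
move=> /subset_card_le/card_le_trans; apply.
apply: bigcup_countable; first exact: countableP.
by move=> n _; apply: weakly_compact_large_countable => //; rewrite divr_gt0 ?invr_gt0 ?ltr0n.
Qed.

End Columns.

(** * Factorising the identity through a diagonal *)

Section Diagonal.
Variables (R : realType) (k : scalar_kind) (I : choiceType).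
Local Notation K := (scalars R k).
Variables (E : completeNormedModType K) (e : symBasis I E).
Variable (X : completeNormedModType K).
Local Notation Z := (fam (basis_solid e) X).
Local Notation single := (single e).

(** V' places V_i z_i at position t i, and U' reads position t i through U_i.
    The off-diagonal entries vanish on the range of t, so position t i of
    T (V' z) only depends on the entry at (t i, t i). *)
Lemma diagonal_factors (T : {linear Z -> Z}) (t : I -> I)
  (U V : I -> {linear X -> X}) (u v : K) : continuous T -> injective t ->
  (forall i j x, i <> j -> T (single (t j) x) (t i) = 0) ->
  0 <= u -> (forall i x, `|U i x| <= u * `|x|) ->
  0 <= v -> (forall i x, `|V i x| <= v * `|x|) ->
  (forall i x, U i (T (single (t i) (V i x)) (t i)) = x) \/
  (forall i x, U i (V i x - T (single (t i) (V i x)) (t i)) = x) ->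
  exists U' V' : {linear Z -> Z}, [/\ forall z, `|U' z| <= u * `|z|,
     forall z, `|V' z| <= v * `|z| & factors T U' V'].
Proof.
move=> Tcont tinj Toff u0 Uu v0 Vv UTV.
have [g gt] : exists g : I -> I, cancel t g.
  have h j : exists i : I, forall i', t i' = j -> i' = i.
    have [[i ij]|h] := pselect (exists i, t i = j).
      by exists i => i'; rewrite -ij => /tinj.
    by exists j => i ij; case: h; exists i.
  by have [g hg] := choice h; exists g => i; apply/esym/hg.
have hU (z : Z) : exists w : Z, (forall i, w i = U i (z (t i))) /\ `|w| <= u * `|z|.
  apply: (@fam_dominated _ _ _ _ _ _ z (fun i => U i (z (t i))) u t) => //.
  by move=> i j _ _ /tinj.
(* The test t (g j) == j singles out the range of t. *)
pose y (z : Z) j : X := if t (g j) == j then V (g j) (z (g j)) else 0.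
have hV (z : Z) : exists w : Z, (forall j, w j = y z j) /\ `|w| <= v * `|z|.
  apply: (@fam_dominated _ _ _ _ _ _ z (y z) v g) => //.
  - by move=> j; rewrite /y; case: eqP.
  - move=> i j; rewrite /y; case: eqP => // ti _; case: eqP => // tj _ gij.
    by rewrite -ti -tj gij.
have [U0 U0P] := choice hU; have [V0 V0P] := choice hV.
have [U' U'E] : exists U' : {linear Z -> Z}, forall z, U' z = U0 z.
  apply: linear_exists => a z w; apply: fam_ext => i.
  by rewrite famD famZ !(U0P _).1 famD famZ linearP.
have [V' V'E] : exists V' : {linear Z -> Z}, forall z, V' z = V0 z.
  apply: linear_exists => a z w; apply: fam_ext => i.
  rewrite famD famZ !(V0P _).1 /y; case: eqP => _; last by rewrite scaler0 addr0.
  by rewrite famD famZ linearP.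
have V'c z i : V' z (t i) = V i (z i).
  by rewrite V'E (V0P _).1 /y gt eqxx.
have [c c0 Tc] := continuous_bound Tcont.
have TV z i : T (V' z) (t i) = T (single (t i) (V i (z i))) (t i).
  apply/eqP; rewrite -subr_eq0 -fam_subE -linearB; apply/eqP.
  pose S : {linear Z -> X} := coord (t i) \o T.
  apply: (@operator_vanish _ _ _ e X X S c).
    by move=> w; apply: le_trans (norm_coord _ _) (Tc w).
  move=> j; rewrite fam_subE singleE.
  have [->|ji] := eqVneq j (t i); first by rewrite V'c subrr !linear0.
  rewrite subr0 V'E (V0P _).1 /y; case: eqP => [jt|_]; last by rewrite !linear0.
  rewrite -{1}jt; apply: Toff => ig; by rewrite -jt -ig eqxx in ji.
exists U', V'; split.
- by move=> z; rewrite U'E (U0P _).2.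
- by move=> z; rewrite V'E (V0P _).2.
case: UTV => UTV; [left|right] => z; apply: fam_ext => i; rewrite U'E (U0P _).1.
  by rewrite TV UTV.
by rewrite fam_subE TV V'c UTV.
Qed.

Definition diagonal_entry (T : {linear Z -> Z}) i : {linear X -> X} :=
  coord i \o (T \o single i).

Lemma diagonal_entry_continuous (T : {linear Z -> Z}) i :
  continuous T -> continuous (diagonal_entry T i).
Proof.
move=> /continuous_bound[c c0 Tc]; apply: (@bound_continuous _ _ _ _ c) => x.
by apply: le_trans (norm_coord _ _) _; rewrite -(norm_single e i x) Tc.
Qed.

Definition off_diagonal_zero (T : {linear Z -> Z}) (D : set I) :=
  forall i j x, D i -> D j -> i <> j -> T (single j x) i = 0.

Hypothesis Iunc : ~ countable [set: I].

Let Iinf : infinite_set [set: I].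
Proof. by move=> /finite_set_countable. Qed.

(** One of the two alternatives in factors holds on a set of indices of full
    cardinality; t enumerates that set injectively. *)
Lemma uniform_factors (T : {linear Z -> Z}) (D : set I) (u v : K) :
  continuous T -> [set: I] #<= D -> off_diagonal_zero T D -> 0 <= u -> 0 <= v ->
  (forall i, D i -> exists U V : {linear X -> X}, [/\ forall x, `|U x| <= u * `|x|,
     forall x, `|V x| <= v * `|x| & factors (diagonal_entry T i) U V]) ->
  exists U V : {linear Z -> Z}, [/\ forall z, `|U z| <= u * `|z|,
     forall z, `|V z| <= v * `|z| & factors T U V].
Proof.
move=> Tcont ID Toff u0 v0 UV.
have hUV i : exists UV : {linear X -> X} * {linear X -> X}, D i ->
   [/\ forall x, `|UV.1 x| <= u * `|x|, forall x, `|UV.2 x| <= v * `|x| &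
       factors (diagonal_entry T i) UV.1 UV.2].
  by have [/UV[U [V hUV]]|nD] := pselect (D i);
     [exists (U, V)|exists (diagonal_entry T i, diagonal_entry T i)].
have {hUV} [W WP] := choice hUV.
pose U i := (W i).1; pose V i := (W i).2.
have UVP i : D i -> [/\ forall x, `|U i x| <= u * `|x|,
    forall x, `|V i x| <= v * `|x| & factors (diagonal_entry T i) (U i) (V i)] by exact: WP.
pose D1 := [set i | D i /\ forall x, U i (diagonal_entry T i (V i x)) = x].
pose D2 := [set i | D i /\ forall x, U i (V i x - diagonal_entry T i (V i x)) = x].
have DD : D `<=` D1 `|` D2.
  by move=> i Di; have [_ _ [h|h]] := UVP i Di; [left|right].
have [i0 _] : exists i : I, True by apply: contrapT => /forallNP h;
  apply: Iunc; have -> : [set: I] = set0 by rewrite -subset0 => i _; apply: (h i).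
have main (D' : set I) : D' `<=` D -> [set: I] #<= D' ->
   (forall i, D' i -> forall x, U i (diagonal_entry T i (V i x)) = x) \/
   (forall i, D' i -> forall x, U i (V i x - diagonal_entry T i (V i x)) = x) ->
   exists U V : {linear Z -> Z}, [/\ forall z, `|U z| <= u * `|z|,
     forall z, `|V z| <= v * `|z| & factors T U V].
  move=> D'D /(card_le_injfun i0)[t [tD tinj]] UTV.
  apply: (@diagonal_factors T t (U \o t) (V \o t) u v) => //.
  - by move=> i j; exact: tinj.
  - move=> i j x ij; apply: Toff; [exact/D'D/tD|exact/D'D/tD|].
    by move=> tij; apply: ij; exact: tinj.
  - by move=> i x; have [] := UVP (t i) (D'D _ (tD i Logic.I)).
  - by move=> i x; have [] := UVP (t i) (D'D _ (tD i Logic.I)).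
  - by case: UTV => h; [left|right] => i x; exact: (h _ (tD i Logic.I)).
have /(card_le_split Iinf)[ID1|ID2] : [set: I] #<= D1 `|` D2.
- by apply: card_le_trans ID _; exact: subset_card_le.
- by apply: (main D1) => // [i []|] //; left => i [].
- by apply: (main D2) => // [i []|] //; right => i [].
Qed.

(** Only the product of the two norms is controlled by C; rescaling moves the
    whole constant to U, so that one bound serves for all indices. *)
Lemma constPFP_normalised (C : K) (S : {linear X -> X}) : 0 <= C ->
  constPFP C X -> continuous S ->
  exists U V : {linear X -> X}, [/\ forall x, `|U x| <= C * `|x|,
    forall x, `|V x| <= 1 * `|x| & factors S U V].
Proof.
move=> C0 XC Scont; have [U [V [_ _ UV]]] := XC S Scont.
move=> [u [v [[u0 Uu _] [v0 Vv _] uvC]]].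
have [v00|vn0] := eqVneq v 0.
  have V0 x : V x = 0 by apply/eqP; rewrite -normr_le0 (le_trans (Vv x))// v00 mul0r.
  have X0 (x : X) : x = 0.
    by case: UV => /(_ x); rewrite V0 (linear0 S) ?subr0 linear0.
  by exists U, V; split => // x; rewrite ?(X0 x) ?linear0 !normr0 mulr0.
have vp : 0 < v by rewrite lt_neqAle eq_sym vn0.
have [U' U'E] : exists U' : {linear X -> X}, forall x, U' x = v *: U x.
  by apply: linear_exists => a x y; rewrite linearP scalerDr !scalerA mulrC.
have [V' V'E] : exists V' : {linear X -> X}, forall x, V' x = v^-1 *: V x.
  by apply: linear_exists => a x y; rewrite linearP scalerDr !scalerA mulrC.
exists U', V'; split.
- move=> x; rewrite U'E normrZ ger0_norm//.
  by rewrite (le_trans (ler_wpM2l v0 (Uu x)))// mulrA ler_wpM2r// mulrC.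
- move=> x; rewrite V'E normrZ normfV ger0_norm// mul1r.
  by rewrite ler_pdivrMl.
- case: UV => UV; [left|right] => x; rewrite U'E V'E linearZ /=.
    by rewrite linearZ /= scalerA divff// scale1r UV.
  by rewrite -scalerBr linearZ /= scalerA divff// scale1r UV.
Qed.

Hypothesis diagonalisable : forall T : {linear Z -> Z}, continuous T ->
  exists2 D : set I, [set: I] #<= D & off_diagonal_zero T D.

(** The constant C is preserved, since the diagonal operators built from U_i and
    V_i obey the bounds C and 1. *)
Lemma UPFP_Esum : UPFP X -> UPFP Z.
Proof.
move=> [C C1 XC]; exists C => // T Tcont.
have C0 : 0 <= C by apply: le_trans C1.
have [D ID Doff] := diagonalisable Tcont.
have [||U [V [UC V1 UV]]] := @uniform_factors T D C 1 Tcont ID Doff C0.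
- by [].
- by move=> i _; apply: constPFP_normalised => //; exact: diagonal_entry_continuous.
have [u uU uC] := opnorm_exists C0 UC; have [v vV v1] := opnorm_exists ler01 V1.
exists U, V; split => //; [exact: bound_continuous UC|exact: bound_continuous V1|].
exists u, v; split => //; rewrite -[leRHS]mulr1.
by have [u0 _ _] := uU; have [v0 _ _] := vV; apply: ler_pM.
Qed.

Lemma UPFP_PFP (Y : completeNormedModType K) : UPFP Y -> PFP Y.
Proof. by move=> [C _ YC] T /YC[U [V [cU cV UV _]]]; exists U, V. Qed.

(** Without a uniform constant the bounds depend on the index i, but they may be
    taken in the natural numbers, and the cofinality assumption provides a
    single n that works on a set of full cardinality. *)
Lemma PFP_Esum_cf : PFP X -> cf_gt_omega I -> PFP Z.
Proof.
move=> XP Icf T Tcont.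
have [D ID Doff] := diagonalisable Tcont.
pose A (n : nat) := [set i | D i /\ exists U V : {linear X -> X},
  [/\ forall x, `|U x| <= n%:R * `|x|, forall x, `|V x| <= n%:R * `|x| &
      factors (diagonal_entry T i) U V]].
have /(cf_gt_omega_bigcup Iunc Icf)[n IA] : [set: I] #<= \bigcup_n A n.
  apply: card_le_trans ID _; apply: subset_card_le => i Di.
  have [U [V [cU cV UV]]] := XP _ (@diagonal_entry_continuous T i Tcont).
  have [u u0 Uu] := continuous_bound cU; have [v v0 Vv] := continuous_bound cV.
  have [m um] := scalars_nat_bound u; have [n vn] := scalars_nat_bound v.
  rewrite (gtr0_norm u0) in um; rewrite (gtr0_norm v0) in vn.
  exists (maxn m n) => //; split=> //; exists U, V; split=> // x.
    by rewrite (le_trans (Uu x))// ler_wpM2r// (le_trans um)// ler_nat leq_maxl.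
  by rewrite (le_trans (Vv x))// ler_wpM2r// (le_trans vn)// ler_nat leq_maxr.
have [||||U [V [Un Vn UV]]] := @uniform_factors T (A n) n%:R n%:R Tcont IA.
- by move=> i j x [Di _] [Dj _]; exact: Doff.
- by rewrite ler0n.
- by rewrite ler0n.
- by move=> i [].
by exists U, V; split=> //; [exact: bound_continuous Un|exact: bound_continuous Vn].
Qed.

End Diagonal.

(** * Diagonalising operators on E(I, X) *)

Section Diagonalisation.
Variables (R : realType) (k : scalar_kind) (I : choiceType).
Local Notation K := (scalars R k).
Variables (E : completeNormedModType K) (e : symBasis I E).
Variable (X : completeNormedModType K).
Local Notation Z := (fam (basis_solid e) X).

Definition nonzero_entries (T : {linear Z -> Z}) (j : I) : set I :=
  [set i | exists x, T (single e j x) i <> 0].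

Lemma free_columns_off_diagonal (T : {linear Z -> Z}) (D : set I) :
  free_set (nonzero_entries T) D -> off_diagonal_zero T D.
Proof.
move=> Dfree i j x Di Dj ij; apply: contrapT => Tx.
by apply: (Dfree j i) => //; [exact/nesym|exists x].
Qed.

Lemma free_rows_off_diagonal (T : {linear Z -> Z}) (D : set I) :
  free_set (fun i => [set j | nonzero_entries T j i]) D -> off_diagonal_zero T D.
Proof.
move=> Dfree i j x Di Dj ij; apply: contrapT => Tx.
by apply: (Dfree i j) => //; exists x.
Qed.

Lemma card_gt_omega1_uncountable : card_gt_omega1 I ->
  exists2 O : set I, ~ countable O & ~ ([set: I] #<= O).
Proof. by move=> [O [Ounc _] [_ nO]]; exists O. Qed.

Lemma nonzero_rows_countable (T : {linear Z -> Z}) i :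
  ~ equivalent_bases e (ell1_basis R k I) ->
  (exists2 M : set (dual X), countable M & total_set M) -> continuous T ->
  countable [set j | nonzero_entries T j i].
Proof.
move=> ne [M Mc Mt] /continuous_bound[c c0 Tc].
apply: (@row_support_countable _ _ _ _ e ne X (coord i \o T) c M Mc Mt) => z.
by apply: le_trans (norm_coord _ _) (Tc z).
Qed.

Lemma column_continuous (T : {linear Z -> Z}) j : continuous T ->
  continuous (T \o single e j : {linear X -> Z}).
Proof.
move=> /continuous_bound[c c0 Tc]; apply: (@bound_continuous _ _ _ _ c) => x.
by rewrite -(norm_single e j x); exact: Tc.
Qed.

Lemma Esum_primary : ~ countable [set: I] ->
  UPFP X \/ (PFP X /\ cf_gt_omega I) ->
  (forall T : {linear Z -> Z}, continuous T ->
    exists2 D : set I, [set: I] #<= D & off_diagonal_zero T D) ->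
  PFP (Esum e X) /\ (UPFP X -> UPFP (Esum e X)).
Proof.
move=> Iunc UFCF diag; split.
  case: UFCF => [XU|[XP cf]]; last exact: PFP_Esum_cf.
  by apply: UPFP_PFP; exact: UPFP_Esum.
exact: UPFP_Esum.
Qed.

End Diagonalisation.

Theorem theorem4p3 (R : realType) (k : scalar_kind) (Gamma : choiceType)
    (X : completeNormedModType (scalars R k))
    (Gamma_uncountable : ~ countable [set: Gamma])
    (UF_or_CF : UPFP X \/ (PFP X /\ cf_gt_omega Gamma)) :
  [/\ card_gt_omega1 Gamma -> WCG X ->
        PFP (Esum (ell1_basis R k Gamma) X) /\
        (UPFP X -> UPFP (Esum (ell1_basis R k Gamma) X)),
      forall (E : completeNormedModType (scalars R k)) (e : symBasis Gamma E),
        ~ equivalent_bases e (ell1_basis R k Gamma) ->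
        separable X ->
        PFP (Esum e X) /\ (UPFP X -> UPFP (Esum e X))
    & forall (E : completeNormedModType (scalars R k)) (e : symBasis Gamma E),
        ~ equivalent_bases e (ell1_basis R k Gamma) ->
        card_gt_omega1 Gamma ->
        (exists2 M : set (dual X), countable M & total_set M) ->
        PFP (Esum e X) /\ (UPFP X -> UPFP (Esum e X))].
Proof.
split.
- move=> /card_gt_omega1_uncountable[O Ounc Olt] XWCG; apply: Esum_primary => // T Tcont.
  have [|D [Dfree GD]] := hajnal_free_set (F := nonzero_entries T) _ Ounc Olt.
    move=> j; apply: (@WCG_column_support_countable R k Gamma X (T \o single _ j) XWCG).
    exact: column_continuous.
  by exists D => //; exact: free_columns_off_diagonal.
- move=> E e ne Xsep; apply: Esum_primary => // T Tcont.
  have [|| D [Dfree GD]] :=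
      free_set_locally_countable (F := nonzero_entries T) Gamma_uncountable.
  + move=> j;
    apply: (@separable_column_support_countable R k X Gamma E e (T \o single e j) Xsep).
    exact: column_continuous.
  + by move=> i; apply: nonzero_rows_countable => //; exact: separable_total.
  by exists D => //; exact: free_columns_off_diagonal.
- move=> E e ne /card_gt_omega1_uncountable[O Ounc Olt] Xtot; apply: Esum_primary => // T Tcont.
  have [|D [Dfree GD]] :=
      hajnal_free_set (F := fun i => [set j | nonzero_entries T j i]) _ Ounc Olt.
    by move=> i; exact: nonzero_rows_countable.
  by exists D => //; exact: free_rows_off_diagonal.
Qed.
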